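(* Let $d\ge 2$ and let $\varphi=\sum_{i=0}^{d-1}\alpha_i e_i\otimes e_i\in\mathbb{C}^d\otimes\mathbb{C}^d$, where $\alpha_0\ge\cdots\ge\alpha_{d-1}>0$ and $\sum_{i=0}^{d-1}\alpha_i^2=1$. There is a unique state $s$ on $\mathcal{O}_d$ such that $s(v_ixv_j^* )=\delta_{ij}\alpha_i^2s(x)$ for all $x\in\mathcal{O}_d$ and $i,j=0,\dots,d-1$. Moreover, if $\mathcal{M}\subseteq\mathcal{B}(\mathcal{H})$ is a von Neumann algebra, $(R,\psi)$ is a monopartite exact embezzlement protocol for $\varphi$ in $(\mathcal{M},\mathcal{H})$, and the marginal $\omega=\langle(\cdot)\psi,\psi\rangle$ of $\psi$ is faithful on $\mathcal{M}$, then for the unital $*$-homomorphism $\pi:\mathcal{O}_d\to\mathcal{M}$ given by $\pi(v_j)=V_j$, where $V_j=R_{j0}^*$, we have $s(x)=\langle\pi(x)\psi,\psi\rangle$ for all $x\in\mathcal{O}_d$.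
   Context: $\mathcal{O}_d$ is the Cuntz algebra: the universal unital $C^*$-algebra generated by $d$ isometries $v_0,\dots,v_{d-1}$ with $v_i^*v_i=1$ for all $i$ and $\sum_iv_iv_i^*=1$ ($d$ Cuntz isometries). Monopartite exact embezzlement protocol: $(R,\psi)$ is a monopartite exact embezzlement protocol for $\varphi$ in $(\mathcal{M},\mathcal{H})$ if $R=\sum_{i,j=0}^{d-1}E_{ij}\otimes R_{ij}\in M_d\otimes\mathcal{M}$ is a contraction ($R_{ij}\in\mathcal{M}$, $E_{ij}$ the matrix units), $\psi\in\mathcal{H}$ is a unit vector, and, with $\omega=\langle(\cdot)\psi,\psi\rangle$, $\omega(R_{i0}^*XR_{j0})=\delta_{ij}\alpha_i^2\omega(X)$ for all $X\in\mathcal{M}$ and $i,j=0,\dots,d-1$. When $\omega$ is faithful on $\mathcal{M}$, the operators $R_{j0}^*$ form a collection of $d$ Cuntz isometries, so $\pi$ exists. *)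

(* Defs.v *)
From HB Require Import structures.
From mathcomp Require Import all_boot all_order all_algebra.
From mathcomp Require Import sesquilinear.
From mathcomp Require Import complex.
From mathcomp Require Import boolp classical_sets functions reals topology.
From mathcomp Require Import normedtype.

Set Implicit Arguments.
Unset Strict Implicit.
Unset Printing Implicit Defensive.

Import Order.TTheory GRing.Theory Num.Theory.
Import numFieldNormedType.Exports.

Local Open Scope classical_set_scope.
Local Open Scope ring_scope.
Local Open Scope complex_scope.

(* The norm is a field of the mixin rather than that of a [normedModType]:
   Hierarchy Builder rejects a structure that inherits from both rings and
   normed modules, because [Num.NumDomain] already does.  As for [normedModType],
   it takes values in the nonnegative elements of [C].
   An [algType] is a nontrivial ring, so [1 != 0] in every [cstarAlgType]. *)
HB.mixin Record isCStarAlgebra (C : numClosedFieldType) A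
    of GRing.Algebra C A := {
  star : A -> A ;
  starD : forall x y : A, star (x + y) = star x + star y ;
  starZ : forall (a : C) (x : A), star (a *: x) = Num.conj a *: star x ;
  starM : forall x y : A, star (x * y) = star y * star x ;
  starK : involutive star ;
  cnorm : A -> C ;
  cnorm_ge0 : forall x : A, 0 <= cnorm x ;
  cnorm0_eq0 : forall x : A, cnorm x = 0 -> x = 0 ;
  cnormZ : forall (a : C) (x : A), cnorm (a *: x) = `|a| * cnorm x ;
  cnormD : forall x y : A, cnorm (x + y) <= cnorm x + cnorm y ;
  cnormM : forall x y : A, cnorm (x * y) <= cnorm x * cnorm y ;
  cnorm_starM : forall x : A, cnorm (star x * x) = cnorm x ^+ 2 ;
  cnorm_complete : forall u : nat -> A,
    (forall e, 0 < e -> exists N, forall m n, (N <= m)%N -> (N <= n)%N ->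
       cnorm (u m - u n) < e) ->
    exists l, forall e, 0 < e -> exists N, forall n, (N <= n)%N ->
       cnorm (u n - l) < e
}.

#[short(type="cstarAlgType")]
HB.structure Definition CStarAlgebra (C : numClosedFieldType) :=
  {A of GRing.Algebra C A & isCStarAlgebra C A}.

(* The inner product is linear in its first argument. *)
HB.mixin Record isHilbert (C : numClosedFieldType) H
    of CompleteNormedModule C H := {
  inner : {dot H for @Num.conj C} ;
  hilbert_norm : forall x : H, `|x| ^+ 2 = inner x x
}.

#[short(type="hilbertType")]
HB.structure Definition Hilbert (C : numClosedFieldType) :=
  {H of CompleteNormedModule C H & isHilbert C H}.

Section CStar.
Variable C : numClosedFieldType.

Definition star_hom (A B : cstarAlgType C) (f : A -> B) : Prop :=
  [/\ linear f, f 1 = 1, {morph f : x y / x * y} & {morph f : x / star x}].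

Definition state (A : cstarAlgType C) (s : A -> C) : Prop :=
  [/\ scalar s, forall x, 0 <= s (star x * x) & s 1 = 1].

Definition star_subalgebra (A : cstarAlgType C) (S : set A) : Prop :=
  [/\ S 1,
      forall (a : C) x y, S x -> S y -> S (a *: x + y),
      forall x y, S x -> S y -> S (x * y) &
      forall x, S x -> S (star x)].

Definition norm_closed (A : cstarAlgType C) (S : set A) : Prop :=
  forall x, (forall e, 0 < e -> exists2 y, S y & cnorm (x - y) < e) -> S x.

Definition cstar_generates (A : cstarAlgType C) (I : Type) (v : I -> A) :=
  forall S : set A, star_subalgebra S -> norm_closed S -> (forall i, S (v i)) ->
  S = setT.

Definition cuntz_isometries (A : cstarAlgType C) d (v : 'I_d -> A) : Prop :=
  (forall i, star (v i) * v i = 1) /\ \sum_i v i * star (v i) = 1.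

(* [A], with generators [v], is the Cuntz algebra O_d.  The homomorphism of the
   universal property is unique because the [v i] generate [A]. *)
Definition cuntz_algebra (A : cstarAlgType C) d (v : 'I_d -> A) : Prop :=
  [/\ cuntz_isometries v, cstar_generates v &
      forall (B : cstarAlgType C) (w : 'I_d -> B), cuntz_isometries w ->
      exists2 f : A -> B, star_hom f & forall i, f (v i) = w i].

End CStar.

Section Operators.
Variables (C : numClosedFieldType) (H : hilbertType C).
Implicit Types (T : H -> H) (M : set (H -> H)).

Local Notation "''[' x , y ]" := (inner x y).

Definition bounded_op : set (H -> H) := [set T | linear T /\ continuous T].

Definition is_adjoint T T' := forall x y, '[T x, y] = '[x, T' y].

(* For bounded [T] over the complex numbers [R[i]], such a [T'] exists, by the
   Riesz representation theorem, and is unique. *)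
Definition adj T : H -> H :=
  get [set T' | bounded_op T' /\ is_adjoint T T'].

Definition positive_op T := forall x, 0 <= '[T x, x].

(* A unital star-subalgebra of B(H) that is closed in the weak operator
   topology. *)
Definition von_neumann_algebra M : Prop :=
  [/\ M `<=` bounded_op,
      M id,
      forall (a : C) S T, M S -> M T -> M (a *: S + T),
      forall S T, M S -> M T -> M (S \o T) &
      forall T, M T -> M (adj T)] /\
  forall T, bounded_op T ->
    (forall n (x y : 'I_n -> H) (e : C), 0 < e ->
      exists2 S, M S & forall k, `|'[S (x k), y k] - '[T (x k), y k]| < e) ->
    M T.

Definition vector_functional (psi : H) T : C := '[T psi, psi].

(* [H -> H] is a [zmodType] pointwise, and the last [0] is the zero operator. *)
Definition faithful_on M (omega : (H -> H) -> C) : Prop :=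
  forall X, M X -> positive_op X -> omega X = 0 -> X = 0.

(* Contractivity of sum_ij E_ij (x) T_ij acting on C^d (x) H, identified with
   the Hilbert space direct sum H^d. *)
Definition opmx_contraction d (T : 'I_d -> 'I_d -> H -> H) : Prop :=
  forall h : 'I_d -> H,
    \sum_i `|\sum_j T i j (h j)| ^+ 2 <= \sum_j `|h j| ^+ 2.

Definition star_hom_into (A : cstarAlgType C) M (f : A -> H -> H) : Prop :=
  [/\ linear f, f 1 = id, forall x y, f (x * y) = f x \o f y,
      forall x, f (star x) = adj (f x) & forall x, M (f x)].

End Operators.

(* The vector phi = sum_i alpha_i (e_i (x) e_i) enters only through its
   Schmidt coefficients alpha. *)
Definition schmidt_coefficients (R : realType) d (alpha : 'I_d -> R) : Prop :=
  [/\ forall i j : 'I_d, (i <= j)%N -> alpha j <= alpha i,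
      forall i, 0 < alpha i & \sum_i alpha i ^+ 2 = 1].

Definition cuntz_kms (R : realType) (A : cstarAlgType R[i]) d
    (alpha : 'I_d -> R) (v : 'I_d -> A) (s : A -> R[i]) : Prop :=
  forall x i j,
    s (v i * x * star (v j)) = (i == j)%:R * (alpha i)%:C ^+ 2 * s x.

Definition exact_embezzlement (R : realType) (H : hilbertType R[i]) d
    (i0 : 'I_d) (alpha : 'I_d -> R) (M : set (H -> H))
    (T : 'I_d -> 'I_d -> H -> H) (psi : H) : Prop :=
  let omega := vector_functional psi in
  [/\ forall i j, M (T i j), opmx_contraction T, `|psi| = 1 &
      forall X, M X -> forall i j,
        omega (adj (T i i0) \o X \o T j i0) =
        (i == j)%:R * (alpha i)%:C ^+ 2 * omega X].

(* Main.v *)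
Require Import Defs.
From HB Require Import structures.
From mathcomp Require Import all_boot all_order all_algebra.
From mathcomp Require Import sesquilinear complex.
From mathcomp Require Import boolp classical_sets functions reals topology.
From mathcomp Require Import normedtype sequences.
From mathcomp Require Import zify ring lra.

(** Write Phi(s)(x) = sum_i alpha_i^2 s(v_i^* x v_i), a map on the states of O_d.
    A state satisfies the KMS-type condition iff Phi(s) = s.  On a word
    v_mu v_nu^* each application of Phi strips one letter from both ends, and
    once one of the words is used up, Phi rotates the other one and multiplies
    by some alpha_i^2 <= alpha_0^2 < 1; hence Phi^n(s) - Phi^n(t) tends to 0 on
    words, uniformly in the states s and t, and by |s(x)| <= |x| on all of O_d.
    So there is at most one fixed state, and Phi^n(s_0) converges to one for any
    state s_0.  A state s_0 comes from the representation of O_d on l^2(N) by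
    e_n |-> e_(dn+i), which needs B(H) to be a C*-algebra (Riesz).

    For a protocol, contractivity of the first column of R gives
    sum_i V_i V_i^* <= 1, and omega of the difference is 0, so faithfulness makes
    it an equality; then sum_i alpha_i^2 omega(V_i^* V_i) =
    sum_(i,j) omega(V_i V_i^* V_j V_j^* ) = 1 with V_i^* V_i <= 1 makes each V_i an
    isometry.  Finally omega o pi is a state satisfying the KMS-type condition. *)

Set Implicit Arguments.
Unset Strict Implicit.
Unset Printing Implicit Defensive.

Import Order.TTheory GRing.Theory Num.Theory.
Import numFieldNormedType.Exports.

Local Open Scope classical_set_scope.
Local Open Scope ring_scope.
Local Open Scope complex_scope.

(** The definition of [state] asks for positivity without continuity, and [star_hom] is purely
    algebraic, so every norm estimate has to be derived. The bound |s(x)| <= |x| comes from a square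
    root of 1 - x^*x/K with K slightly above |x^*x|, and contractivity of a representation then
    follows from the bound for its vector states. The relation v_i^* v_j = 0 for i <> j is used only
    under a state, where Cauchy-Schwarz supplies it. The condition d >= 2 makes alpha_0^2 < 1. For d
    = 1 the algebra is C(T), the KMS-type condition is void and uniqueness fails. The universal
    property yields a map only towards an algebra in which Cuntz isometries are already known. Hence
    the explicit model on l^2(N) for s_0, and hence the V_j must be shown to be Cuntz isometries of
    B(H) before pi can be formed. That pi takes values in M is a separate density argument. *)

Local Notation Re := complex.Re.
Local Notation Im := complex.Im.

(** * Real-valued norms, limits and Riesz representation *)

Section ComplexFacts.
Variable R : realType.
Implicit Types z w : R[i].

Lemma cReD z w : Re (z + w) = Re z + Re w. Proof. by case: z w => ? ? []. Qed.
Lemma cImD z w : Im (z + w) = Im z + Im w. Proof. by case: z w => ? ? []. Qed.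
Lemma cReN z : Re (- z) = - Re z. Proof. by case: z. Qed.
Lemma cImN z : Im (- z) = - Im z. Proof. by case: z. Qed.
Lemma cReM z w : Re (z * w) = Re z * Re w - Im z * Im w.
Proof. by case: z w => ? ? []. Qed.
Lemma cImM z w : Im (z * w) = Re z * Im w + Im z * Re w.
Proof. by case: z w => ? ? []. Qed.

Lemma ge0_ReE z : 0 <= z -> z = (Re z)%:C.
Proof. by case: z => a b; rewrite lecE /= => /andP[/eqP -> _]. Qed.

Lemma gt0_Re z : 0 < z -> 0 < Re z.
Proof. by rewrite ltcE => /andP[]. Qed.

Lemma ge0_Re z : 0 <= z -> 0 <= Re z.
Proof. by rewrite lecE => /andP[]. Qed.

(** The norm takes values in the partially ordered field [R[i]]; its real part lies in [R], where
    suprema, square roots and [nra] are at hand. *)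
Definition nm (V : normedZmodType R[i]) (x : V) : R := Re `|x|.

Section Norm.
Variable V : normedZmodType R[i].
Implicit Types x y : V.

Lemma nmE x : `|x| = (nm x)%:C.
Proof. exact/ge0_ReE/normr_ge0. Qed.

Lemma nm_ge0 x : 0 <= nm x.
Proof. exact/ge0_Re/normr_ge0. Qed.

Lemma nmD x y : nm (x + y) <= nm x + nm y.
Proof. by rewrite -lecR rmorphD /= -!nmE ler_normD. Qed.

Lemma nmN x : nm (- x) = nm x.
Proof. by rewrite /nm normrN. Qed.

Lemma nmBC x y : nm (x - y) = nm (y - x).
Proof. by rewrite -nmN opprB. Qed.

Lemma nmB_trans y x (z : V) : nm (x - z) <= nm (x - y) + nm (y - z).
Proof. by rewrite -[x in leLHS](subrK y) -addrA nmD. Qed.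

Lemma nm0 : nm (0 : V) = 0.
Proof. by rewrite /nm normr0. Qed.

Lemma nm0_eq0 x : nm x = 0 -> x = 0.
Proof. by move=> x0; apply/normr0_eq0; rewrite nmE x0. Qed.

Lemma nm_sum (I : Type) (r : seq I) (F : I -> V) :
  nm (\sum_(i <- r) F i) <= \sum_(i <- r) nm (F i).
Proof.
elim/big_ind2: _ => [|a b c e ab ce|//]; first by rewrite nm0.
by rewrite (le_trans (nmD _ _))// lerD.
Qed.

End Norm.

Lemma nmM z w : nm (z * w) = nm z * nm w.
Proof. by apply: (@complexI R); rewrite rmorphM /= -!nmE normrM. Qed.

Lemma nmC (a : R) : nm (a%:C) = `|a|.
Proof. by rewrite /nm normc_def /= expr0n addr0 sqrtr_sqr. Qed.

Lemma nmZ (V : normedModType R[i]) z (x : V) : nm (z *: x) = nm z * nm x.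
Proof. by apply: (@complexI R); rewrite rmorphM /= -!nmE normrZ. Qed.

Lemma nm_sqr z : nm z ^+ 2 = Re z ^+ 2 + Im z ^+ 2.
Proof. by rewrite /nm normc_def /= sqr_sqrtr// addr_ge0// sqr_ge0. Qed.

Lemma Re_le_nm z : `|Re z| <= nm z.
Proof.
by rewrite -ler_sqr ?nnegrE ?nm_ge0// nm_sqr real_normK ?num_real// lerDl sqr_ge0.
Qed.

Lemma Im_le_nm z : `|Im z| <= nm z.
Proof.
by rewrite -ler_sqr ?nnegrE ?nm_ge0// nm_sqr real_normK ?num_real// lerDr sqr_ge0.
Qed.

Lemma conjr_real (a : R) : Num.conj a%:C = a%:C.
Proof. exact: conjc_real. Qed.

Lemma nm_conj z : nm (Num.conj z) = nm z.
Proof. by case: z => a b; rewrite /nm !normc_def /= sqrrN. Qed.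

Lemma nm_ReIm z : nm z <= `|Re z| + `|Im z|.
Proof.
rewrite -ler_sqr ?nnegrE ?nm_ge0 ?addr_ge0// nm_sqr sqrrD !real_normK ?num_real//.
by rewrite lerD2r lerDl mulrn_wge0// mulr_ge0.
Qed.

Lemma small_inv (e : R) : 0 < e -> exists N, forall n, (N <= n)%N -> n.+1%:R^-1 < e.
Proof.
move=> e0; exists (Num.bound e^-1) => n Nn.
rewrite invf_plt ?posrE//.
have ei : 0 <= e^-1 by rewrite invr_ge0 ltW.
by apply: (lt_le_trans (archi_boundP ei)); rewrite ler_nat (leq_trans Nn).
Qed.

Lemma le_eps (a b : R) : (forall e, 0 < e -> a <= b + e) -> a <= b.
Proof. by move=> h; apply/ler_addgt0Pr. Qed.

Definition cauchy_sequence (V : normedZmodType R[i]) (u : nat -> V) :=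
  forall e : R, 0 < e -> exists N, forall m n, (N <= m)%N -> (N <= n)%N ->
    nm (u m - u n) < e.

Definition tends_to (V : normedZmodType R[i]) (u : nat -> V) l :=
  forall e : R, 0 < e -> exists N, forall n, (N <= n)%N -> nm (u n - l) < e.

Lemma tends_unique (V : normedZmodType R[i]) (u : nat -> V) l l' :
  tends_to u l -> tends_to u l' -> l = l'.
Proof.
move=> ul ul'; apply/subr0_eq/nm0_eq0/le_anti; rewrite nm_ge0 andbT.
apply: le_eps => e e0; rewrite add0r.
have e2 : 0 < e / 2 by rewrite divr_gt0.
have [N hN] := ul _ e2; have [N' hN'] := ul' _ e2.
have h := hN (maxn N N') (leq_maxl _ _); have h' := hN' (maxn N N') (leq_maxr _ _).
by rewrite (le_trans (nmB_trans (u (maxn N N')) _ _))// nmBC (splitr e) lerD// ltW.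
Qed.

Lemma tends_to_lin (u w : nat -> R[i]) a l l' : tends_to u l -> tends_to w l' ->
  tends_to (fun n => a * u n + w n) (a * l + l').
Proof.
move=> ul wl' e e0.
have K0 : 0 < nm a + 1 by rewrite ltr_wpDl// nm_ge0.
have e2 : 0 < e / 2 by rewrite divr_gt0.
have [N hN] := ul _ (divr_gt0 e2 K0); have [N' hN'] := wl' _ e2.
exists (maxn N N') => n; rewrite geq_max => /andP[Nn N'n].
rewrite opprD addrACA -mulrBr (le_lt_trans (nmD _ _))//.
rewrite (splitr e) ler_ltD ?hN'// nmM.
have := hN n Nn; rewrite ltr_pdivlMr// => /ltW; apply: le_trans.
by rewrite mulrC ler_wpM2l ?nm_ge0// lerDl.
Qed.

Lemma complete_seq (V : completeNormedModType R[i]) (u : nat -> V) :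
  cauchy_sequence u -> exists l, tends_to u l.
Proof.
move=> cu.
have : cvg (u @ \oo).
  apply/cauchy_cvgP/cauchy_ballP => e e0.
  have [N hN] := cu _ (gt0_Re e0).
  exists ([set u n | n in [set n | (N <= n)%N]], [set u n | n in [set n | (N <= n)%N]]).
    by split; exists N => //= n Nn; exists n.
  move=> [_ _] /= [[m Nm <-] [n Nn <-]].
  by rewrite -ball_normE /= nmE (ge0_ReE (ltW e0)) ltcR hN.
move=> /cvg_ex[l ul]; exists l => e e0.
move/cvgrPdist_lt : ul => /(_ e%:C); rewrite ltcR => /(_ e0)[N _ hN].
by exists N => n Nn; rewrite nmBC -ltcR -nmE; apply: hN.
Qed.

(** [Re] and [Im] are additive and dominated by [nm], so both coordinate sequences are Cauchy in
    [R]. *)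
Lemma complete_complex (u : nat -> R[i]) :
  cauchy_sequence u -> exists l, tends_to u l.
Proof.
move=> cu.
have real_case (f : R[i] -> R) : (forall z w, f (z - w) = f z - f w) ->
    (forall z, `|f z| <= nm z) ->
    exists l, forall e : R, 0 < e -> exists N, forall n, (N <= n)%N -> `|f (u n) - l| < e.
  move=> fB fn; have : cvg ((f \o u) @ \oo).
    apply/cauchy_cvgP/cauchy_ballP => e e0; have [N hN] := cu _ e0.
    exists ([set f (u n) | n in [set n | (N <= n)%N]],
            [set f (u n) | n in [set n | (N <= n)%N]]).
      by split; exists N => //= n Nn; exists n.
    move=> [_ _] /= [[m Nm <-] [n Nn <-]].
    by rewrite -ball_normE /= -fB (le_lt_trans (fn _))// hN.
  move=> /cvg_ex[l ul]; exists l => e e0.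
  move/cvgrPdist_lt : ul => /(_ e e0)[N _ hN].
  by exists N => n Nn; rewrite distrC; apply: hN.
have [|a ha] := real_case (@Re R) _ Re_le_nm; first by move=> z w; rewrite cReD cReN.
have [|b hb] := real_case (@Im R) _ Im_le_nm; first by move=> z w; rewrite cImD cImN.
exists (a +i* b) => e e0.
have e2 : 0 < e / 2 by rewrite divr_gt0.
have [N hN] := ha _ e2; have [N' hN'] := hb _ e2.
exists (maxn N N') => n; rewrite geq_max => /andP[Nn N'n].
rewrite (le_lt_trans (nm_ReIm _))// cReD cImD cReN cImN /= (splitr e).
by rewrite ltrD ?hN ?hN'.
Qed.

End ComplexFacts.

(** * Hilbert space geometry, Riesz representation and adjoints *)

Section HilbertFacts.
Variables (R : realType) (H : hilbertType R[i]).
Implicit Types (x y z : H) (a : R[i]).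
Local Notation "''[' x , y ]" := (inner x y).

Lemma innerDl x y z : '[x + y, z] = '[x, z] + '[y, z].
Proof. exact: linearDl. Qed.
Lemma innerDr x y z : '[x, y + z] = '[x, y] + '[x, z].
Proof. exact: linearDr. Qed.
Lemma innerNl x y : '[- x, y] = - '[x, y].
Proof. exact: linearNl. Qed.
Lemma innerNr x y : '[x, - y] = - '[x, y].
Proof. exact: linearNr. Qed.
Lemma innerZl a x y : '[a *: x, y] = a * '[x, y].
Proof. exact: linearZl_LR. Qed.
Lemma innerZr a x y : '[x, a *: y] = Num.conj a * '[x, y].
Proof. exact: linearZr_LR. Qed.
Lemma inner0r x : '[x, 0] = 0.
Proof. exact: linear0r. Qed.
Lemma innerC x y : '[x, y] = Num.conj '[y, x].
Proof. by rewrite hermC expr0 mul1r. Qed.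
Lemma inner_nm x : '[x, x] = (nm x ^+ 2)%:C.
Proof. by rewrite -hilbert_norm nmE rmorphXn. Qed.

Lemma Re_innerC x y : Re '[x, y] = Re '[y, x].
Proof. by rewrite innerC; case: '[y, x]. Qed.

Lemma nm_sqrD x y : nm (x + y) ^+ 2 = nm x ^+ 2 + 2 * Re '[x, y] + nm y ^+ 2.
Proof.
have E z : nm z ^+ 2 = Re '[z, z] by rewrite inner_nm.
by rewrite !E !(innerDl, innerDr, cReD) (Re_innerC y x); ring.
Qed.

Lemma nm_sqrB x y : nm (x - y) ^+ 2 = nm x ^+ 2 - 2 * Re '[x, y] + nm y ^+ 2.
Proof. by rewrite nm_sqrD innerNr cReN nmN mulrN. Qed.

(** The square of the norm of |y| x - |x| y is 2 |x| |y| (|x| |y| - Re <x, y>). *)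
Lemma CauchySchwarz_Re x y : Re '[x, y] <= nm x * nm y.
Proof.
have [y0|yn0] := eqVneq (nm y) 0.
  by rewrite (nm0_eq0 y0) inner0r nm0 mulr0.
have yp : 0 < nm y by rewrite lt_def yn0 nm_ge0.
have [x0|xn0] := eqVneq (nm x) 0.
  by rewrite (nm0_eq0 x0) Re_innerC inner0r nm0 mul0r.
have xp : 0 < nm x by rewrite lt_def xn0 nm_ge0.
have := sqr_ge0 (nm ((nm y)%:C *: x - (nm x)%:C *: y)).
rewrite nm_sqrB !nmZ !nmC innerZl innerZr conjr_real !cReM /= !mul0r !subr0.
rewrite !ger0_norm ?nm_ge0// => h.
have : 0 <= nm x * nm y * (nm x * nm y - Re '[x, y]) by nra.
by rewrite pmulr_rge0 ?mulr_gt0// subr_ge0.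
Qed.

(** Scaling x by the conjugate of <x, y> makes the inner product the real number |<x, y>|^2, which
    reduces the claim to real parts. *)
Lemma CauchySchwarz x y : nm '[x, y] <= nm x * nm y.
Proof.
have [->|n0] := eqVneq '[x, y] 0; first by rewrite nm0 mulr_ge0 ?nm_ge0.
have np : 0 < nm '[x, y].
  by rewrite lt_def nm_ge0 andbT; apply: contra_neq n0 => /nm0_eq0.
have := CauchySchwarz_Re (Num.conj '[x, y] *: x) y.
have -> : Re '[Num.conj '[x, y] *: x, y] = nm '[x, y] ^+ 2.
  by rewrite innerZl nm_sqr; case: '[x, y] => a b /=; ring.
by rewrite nmZ nm_conj expr2 -mulrA ler_pM2l.
Qed.

Lemma inner_inj y z : (forall x, '[x, y] = '[x, z]) -> y = z.
Proof.
move=> h; apply/subr0_eq/nm0_eq0/eqP; rewrite -sqrf_eq0.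
apply/eqP/(@complexI R); rewrite -inner_nm.
by rewrite innerDr innerNr h subrr.
Qed.

(** The imaginary part is recovered from Re f(i x) = - Im f(x). *)
Lemma Re_inj (f g : H -> R[i]) : scalar f -> scalar g ->
  (forall x, Re (f x) = Re (g x)) -> forall x, f x = g x.
Proof.
move=> lf lg e x; have := e ('i%C *: x).
have Z (k : H -> R[i]) a : scalar k -> k (a *: x) = a * k x.
  move=> lk; have k0 : k 0 = 0.
    by have := lk (-1) 0 0; rewrite scaler0 addr0 mulN1r addNr.
  by rewrite -[a *: x]addr0 lk k0 addr0.
rewrite !Z// !cReM /= !mul0r !mul1r !sub0r => /oppr_inj; have := e x.
by case: (f x) (g x) => a b [a' b'] /= -> ->.
Qed.

(* The minimiser of [|x|^2 - 2 Re f(x)] represents f; minimising sequences are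
   Cauchy by the parallelogram identity. *)
Theorem Riesz (f : H -> R[i]) (M : R) : scalar f ->
  (forall x, nm (f x) <= M * nm x) -> exists y, forall x, f x = '[x, y].
Proof.
move=> lf fM.
pose J x := nm x ^+ 2 - 2 * Re (f x).
have fZ a x : f (a *: x) = a * f x.
  have f0 : f 0 = 0 by have := lf (-1) 0 0; rewrite scaler0 addr0 mulN1r addNr.
  by rewrite -[a *: x]addr0 lf f0 addr0.
have fD x y : f (x + y) = f x + f y by rewrite -{1}[x]scale1r lf mul1r.
have JE x : J x = nm x ^+ 2 - 2 * Re (f x) by [].
(* J x >= |x|^2 - 2 M |x| = (|x| - M)^2 - M^2. *)
have Jlb x : - M ^+ 2 <= J x.
  have := le_trans (le_trans (ler_norm _) (Re_le_nm (f x))) (fM x).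
  by rewrite JE => h; have := sqr_ge0 (nm x - M); nra.
pose m := inf (range J).
have hi : has_inf (range J).
  by split; [exists (J 0), 0|exists (- M ^+ 2) => _ [x _ <-]].
have mJ x : m <= J x by apply: ge_inf; [exact: hi.2|exists x].
have hu n : exists x, J x < m + n.+1%:R^-1.
  have [|_ [x _ <-] h] := @inf_adherent _ (range J) n.+1%:R^-1 _ hi; last by exists x.
  by rewrite invr_gt0.
have [u uP] := choice hu.
have par x y : nm (x - y) ^+ 2 = 2 * (J x + J y) - 4 * J (2^-1%:C *: (x + y)).
  rewrite !JE fZ fD nmZ nmC ger0_norm ?invr_ge0// exprMn nm_sqrB nm_sqrD cReM cReD /=.
  by field.
clearbody m J.
have [|y uy] := @complete_seq _ _ u.
  (* Since J is at least m at the midpoint, [par] bounds |u i - u j|^2 by 2/(i+1) + 2/(j+1); hence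
     e^2/4. *)
  move=> e e0; have [|N hN] := @small_inv _ (e ^+ 2 / 4).
    by rewrite divr_gt0 ?exprn_gt0.
  exists N => i j Ni Nj; rewrite -ltr_sqr ?nnegrE ?nm_ge0 ?(ltW e0)// par.
  have := uP i; have := uP j; have := hN i Ni; have := hN j Nj.
  have := mJ (2^-1%:C *: (u i + u j)).
  move: (J _) (J (u i)) (J (u j)) => a b c.
  by move: (i.+1%:R^-1) (j.+1%:R^-1) => p q; lra.
exists y; apply: Re_inj => //.
  by move=> a x z; rewrite innerDl innerZl.
(* c is half the derivative of J at y in the direction h. *)
move=> h; rewrite (Re_innerC h); set c := Re '[y, h] - Re (f h).
suff c0 : c = 0 by move/eqP: c0; rewrite subr_eq0 => /eqP ->.
(* This is J(u n + t h) >= m > J(u n) - 1/(n+1) in the limit; only the term linear in t depends on u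
   n, so J is never evaluated at y. *)
have key t : 0 <= 2 * t * c + t ^+ 2 * nm h ^+ 2.
  apply: le_eps => e e0; set K := 2 * (`|t| * nm h) + 1.
  have K0 : 0 < K by rewrite ltr_wpDl// !mulr_ge0 ?nm_ge0.
  have [N1 hN1] := small_inv (divr_gt0 e0 (ltr0Sn _ 1)).
  have [N2 hN2] := uy _ (divr_gt0 (divr_gt0 e0 (ltr0Sn _ 1)) K0).
  set n := maxn N1 N2.
  have h1 := hN1 n (leq_maxl _ _); have h2 := hN2 n (leq_maxr _ _).
  have := mJ (u n + t%:C *: h); have := uP n.
  rewrite !JE nm_sqrD innerZr conjr_real cReM /= mul0r subr0 nmZ nmC exprMn.
  rewrite real_normK ?num_real// fD fZ cReD cReM /= mul0r subr0.
  have h3 : 2 * t * (Re '[u n, h] - Re '[y, h]) <= e / 2.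
    have := le_trans (Re_le_nm _) (CauchySchwarz (u n - y) h).
    rewrite innerDl innerNl cReD cReN => h3.
    apply: (le_trans (ler_norm _)); rewrite !normrM ger0_norm//.
    apply: (@le_trans _ _ (2 * `|t| * (nm (u n - y) * nm h))).
      by rewrite ler_wpM2l// mulr_ge0.
    apply: (@le_trans _ _ (K * nm (u n - y))).
      have := nm_ge0 (u n - y); rewrite /K; nra.
    by move: h2; rewrite ltr_pdivlMr// mulrC => /ltW.
  by rewrite /c; move: (n.+1%:R^-1) h1 => k h1; lra.
set q := nm h ^+ 2 in key; have q0 : 0 <= q by exact: sqr_ge0.
apply/eqP; rewrite -sqrf_eq0 eq_le sqr_ge0 andbT.
(* The minimising t would be -c/q; the added 1 covers q = 0 and still leaves a negative multiple of
   c^2. *)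
have := key (- c / (q + 1)).
have -> : 2 * (- c / (q + 1)) * c + (- c / (q + 1)) ^+ 2 * q
    = - (c ^+ 2 * ((q + 2) / (q + 1) ^+ 2)) by field; lra.
by rewrite oppr_ge0 pmulr_lle0// divr_gt0 ?exprn_gt0//; lra.
Qed.

Lemma linear_Z (T : H -> H) : linear T -> forall a x, T (a *: x) = a *: T x.
Proof.
move=> lT a x; have T0 : T 0 = 0.
  by have := lT (-1) 0 0; rewrite scaler0 addr0 scaleN1r addNr.
by rewrite -[a *: x]addr0 lT T0 addr0.
Qed.

Lemma linear_D (T : H -> H) : linear T -> forall x y, T (x + y) = T x + T y.
Proof. by move=> lT x y; rewrite -{1}[x]scale1r lT scale1r. Qed.

Lemma linear_B (T : H -> H) : linear T -> forall x y, T (x - y) = T x - T y.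
Proof. by move=> lT x y; rewrite -scaleN1r linear_D// linear_Z// scaleN1r. Qed.

Lemma bounded_opP (T : H -> H) : bounded_op T <->
  linear T /\ exists M : R, 0 <= M /\ forall x, nm (T x) <= M * nm x.
Proof.
split=> [[lT cT]|[lT [M [M0 TM]]]]; split=> //.
  have T0 : T 0 = 0 by have := linear_Z lT 0 0; rewrite !scale0r.
  have /cvgrPdist_lt/(_ 1 ltr01) := cT 0.
  rewrite T0 => /nbhs_ballP[e /= e0]; rewrite -ball_normE => he.
  pose r := Re e; have r0 : 0 < r by exact: gt0_Re.
  have hr x : nm x < r -> nm (T x) < 1.
    move=> xr; have := he x; rewrite /= !sub0r !normrN -ltcR -nmE; apply.
    by rewrite nmE (ge0_ReE (ltW e0)) ltcR.
  exists (2 / r); split=> [|x]; first by rewrite divr_ge0// ltW.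
  have [->|xn0] := eqVneq x 0; first by rewrite T0 nm0 mulr0.
  have xp : 0 < nm x.
    by rewrite lt_def nm_ge0 andbT; apply: contra_neq xn0 => /nm0_eq0.
  (* k rescales x to norm r/2, strictly inside the ball on which |T x| < 1. *)
  set k := r / 2 / nm x; have kp : 0 < k by rewrite !divr_gt0.
  have := hr (k%:C *: x); rewrite linear_Z// !nmZ !nmC gtr0_norm//.
  have rn0 := gt_eqF r0; have nxn0 := gt_eqF xp; have kn0 := gt_eqF kp.
  have -> : k * nm x = r / 2 by rewrite /k; field; rewrite nxn0.
  have -> : 2 / r * nm x = k^-1 by rewrite /k; field; rewrite rn0 nxn0.
  move=> /(_ _)/ltW h; rewrite -[k^-1]mul1r ler_pdivlMr// mulrC h//.
  by rewrite ltr_pdivrMr// ltr_pMr// ltr1n.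
move=> x; apply/cvgrPdist_lt => e e0; apply/nbhs_ballP.
have r0 : 0 < Re e / (M + 1) by rewrite divr_gt0 ?gt0_Re//; lra.
exists (Re e / (M + 1))%:C => /=; first by rewrite ltcR.
move=> y; rewrite -ball_normE /= nmE ltcR => h.
rewrite -linear_B// nmE (ge0_ReE (ltW e0)) ltcR.
apply: (le_lt_trans (TM _)).
apply: (@le_lt_trans _ _ ((M + 1) * nm (x - y))); first by have := nm_ge0 (x - y); nra.
by rewrite mulrC -ltr_pdivlMr//; lra.
Qed.

Section Adjoint.
Implicit Types S T : H -> H.

(** [adj] is a choice, meaningful once some adjoint T' exists: Riesz gives T' y for each y, and |T'
    y|^2 = <T T' y, y> bounds it. *)
Lemma adjP T : bounded_op T -> bounded_op (adj T) /\ is_adjoint T (adj T).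
Proof.
move=> bT; apply: (@getPex _ [set T' | bounded_op T' /\ is_adjoint T T']).
have [lT [M [M0 TM]]] := (bounded_opP T).1 bT.
have /choice[T' hT'] : forall y, exists z, forall x, '[T x, y] = '[x, z].
  move=> y; apply: (@Riesz _ (M * nm y)) => [a x x'|x].
    by rewrite lT innerDl innerZl.
  by rewrite (le_trans (CauchySchwarz _ _))// mulrAC ler_wpM2r ?nm_ge0.
exists T'; split; last by move=> x y.
apply/bounded_opP; split.
  move=> a y y'; apply: inner_inj => x.
  by rewrite -hT' !innerDr !innerZr !hT'.
exists M; split=> // y; set z := T' y.
have [z0|zn0] := eqVneq (nm z) 0; first by rewrite z0 mulr_ge0// nm_ge0.
have zp : 0 < nm z by rewrite lt_def zn0 nm_ge0.
rewrite -(ler_pM2l zp) -expr2.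
have := CauchySchwarz_Re (T z) y; rewrite hT' inner_nm /= => /le_trans; apply.
by rewrite mulrA ler_wpM2r ?nm_ge0// mulrC TM.
Qed.

Lemma adj_unique T S : bounded_op T -> is_adjoint T S -> adj T = S.
Proof.
move=> bT hS; apply/funext => y; apply: inner_inj => x.
by rewrite -(adjP bT).2 hS.
Qed.

Lemma inner_adjl T x y : bounded_op T -> '[adj T x, y] = '[x, T y].
Proof. by move=> bT; rewrite innerC -(adjP bT).2 -innerC. Qed.

Lemma adjK T : bounded_op T -> adj (adj T) = T.
Proof.
move=> bT; apply: adj_unique; first exact: (adjP bT).1.
by move=> x y; exact: inner_adjl.
Qed.

End Adjoint.

End HilbertFacts.

(** * B(H) as a C*-algebra *)

Section BoundedOperators.
Variables (R : realType) (H : hilbertType R[i]).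
Implicit Types (S T : H -> H) (x y : H).
Local Notation "''[' x , y ]" := (inner x y).

Definition op_bound T : set R :=
  [set M | 0 <= M /\ forall x, nm (T x) <= M * nm x].

Definition opnorm T : R := inf (op_bound T).

Lemma op_bound_has_inf T : bounded_op T -> has_inf (op_bound T).
Proof.
move=> /bounded_opP[_ [M MP]]; split; first by exists M.
by exists 0 => ? [].
Qed.

Lemma opnorm_le T M : 0 <= M -> (forall x, nm (T x) <= M * nm x) -> opnorm T <= M.
Proof. by move=> M0 TM; apply: ge_inf => //; exists 0 => ? []. Qed.

Lemma opnorm_ge0 T : bounded_op T -> 0 <= opnorm T.
Proof. by move=> /op_bound_has_inf[ne _]; apply: lb_le_inf => // ? []. Qed.

Lemma opnormP T x : bounded_op T -> nm (T x) <= opnorm T * nm x.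
Proof.
move=> bT; have [x0|xn0] := eqVneq (nm x) 0.
  by have /bounded_opP[_ [M [_ /(_ x)]]] := bT; rewrite x0 !mulr0.
have xp : 0 < nm x by rewrite lt_def xn0 nm_ge0.
rewrite -ler_pdivrMr//; apply: lb_le_inf; first exact: (op_bound_has_inf bT).1.
by move=> M [_ /(_ x)]; rewrite ler_pdivrMr.
Qed.

Lemma bounded_op_id : bounded_op (id : H -> H).
Proof.
by apply/bounded_opP; split => //; exists 1; split => // x; rewrite mul1r.
Qed.

Lemma bounded_op_comp S T : bounded_op S -> bounded_op T -> bounded_op (S \o T).
Proof.
move=> bS bT; apply/bounded_opP; split=> [a x y /=|]; first by rewrite bT.1 bS.1.
exists (opnorm S * opnorm T); split=> [|x /=].
  by rewrite mulr_ge0 ?opnorm_ge0.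
by rewrite (le_trans (opnormP _ bS))// -mulrA ler_wpM2l ?opnorm_ge0// opnormP.
Qed.

Lemma bounded_op_lin a S T : bounded_op S -> bounded_op T -> bounded_op (a *: S + T).
Proof.
move=> bS bT; apply/bounded_opP; split=> [b x y|].
  by rewrite addrfctE scalrfctE bT.1 bS.1 !scalerDr !scalerA mulrC addrACA.
exists (nm a * opnorm S + opnorm T); split=> [|x].
  by rewrite addr_ge0 ?mulr_ge0 ?opnorm_ge0 ?nm_ge0.
rewrite addrfctE scalrfctE (le_trans (nmD _ _))// mulrDl lerD ?opnormP//.
by rewrite nmZ -mulrA ler_wpM2l ?nm_ge0// opnormP.
Qed.

Lemma bounded_op0 : bounded_op (0 : H -> H).
Proof.
apply/bounded_opP; split=> [a x y|]; first by rewrite scaler0 addr0.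
by exists 0; split => // x; rewrite mul0r nm0.
Qed.

(** In boolean form, so that [bop] inherits its vector space structure as a submodule of
    [H -> H]. *)
Definition bounded_pred : {pred H -> H} := fun T => `[< bounded_op T >].

Lemma bounded_pred_closed : subsemimod_closed bounded_pred.
Proof.
split; first (split; first exact/asboolP/bounded_op0).
  move=> S T /asboolP bS /asboolP bT; apply/asboolP.
  by rewrite -[S]scale1r; exact: bounded_op_lin.
move=> a T /asboolP bT; apply/asboolP; rewrite -[a *: T]addr0.
by apply: bounded_op_lin => //; exact: bounded_op0.
Qed.

HB.instance Definition _ :=
  GRing.isSubmodClosed.Build R[i] (H -> H) bounded_pred bounded_pred_closed.

(* [H_neq0] gives 1 != 0, which [algType] requires. *)
Record bop (H_neq0 : exists x : H, x != 0) :=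
  Bop { bop_val :> H -> H; bop_valP : bop_val \in bounded_pred }.

End BoundedOperators.

Section BoundedOperatorsAlgebra.
Variables (R : realType) (H : hilbertType R[i]) (H_neq0 : exists x : H, x != 0).
Local Notation B := (bop H_neq0).
Local Notation "''[' x , y ]" := (inner x y).

HB.instance Definition _ := [isSub for @bop_val R H H_neq0].
HB.instance Definition _ := [Choice of B by <:].
HB.instance Definition _ := [SubChoice_isSubLmodule of B by <:].

Implicit Types (S T U : B) (x y : H).

Lemma bopP T : bounded_op T. Proof. exact/asboolP/bop_valP. Qed.

Lemma bop_ext S T : (forall x, S x = T x) -> S = T.
Proof. by move=> h; apply/val_inj/funext. Qed.

Definition bop_of (f : H -> H) (bf : bounded_op f) : B := Bop H_neq0 (asboolT bf).

Definition bop1 : B := bop_of (@bounded_op_id R H).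
Definition bop_mul S T : B := bop_of (bounded_op_comp (bopP S) (bopP T)).
Definition bop_star T : B := bop_of (adjP (bopP T)).1.

Lemma bopDE S T x : (S + T) x = S x + T x. Proof. by []. Qed.
Lemma bopZE a T x : (a *: T) x = a *: T x. Proof. by []. Qed.

Lemma bop_mulA : associative bop_mul. Proof. by move=> S T U; exact: bop_ext. Qed.
Lemma bop_mul1l : left_id bop1 bop_mul. Proof. by move=> T; exact: bop_ext. Qed.
Lemma bop_mul1r : right_id bop1 bop_mul. Proof. by move=> T; exact: bop_ext. Qed.
Lemma bop_mulDl : left_distributive bop_mul +%R.
Proof. by move=> S T U; exact: bop_ext. Qed.
Lemma bop_mulDr : right_distributive bop_mul +%R.
Proof.
move=> S T U; apply: bop_ext => x; rewrite bopDE /=.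
by rewrite -(linear_D (bopP S).1).
Qed.
Lemma bop1_neq0 : bop1 != 0.
Proof.
case: H_neq0 => x; apply: contra_neq => e.
by have := congr1 (fun T : B => T x) e.
Qed.

HB.instance Definition _ := GRing.Zmodule_isNzRing.Build B
  bop_mulA bop_mul1l bop_mul1r bop_mulDl bop_mulDr bop1_neq0.

Lemma bop_scalerAl (a : R[i]) S T : a *: (S * T) = (a *: S) * T.
Proof. exact: bop_ext. Qed.

HB.instance Definition _ := GRing.Lmodule_isLalgebra.Build R[i] B bop_scalerAl.

Lemma bop_scalerAr (a : R[i]) S T : a *: (S * T) = S * (a *: T).
Proof. by apply: bop_ext => x; rewrite bopZE /= -(linear_Z (bopP S).1). Qed.

HB.instance Definition _ := GRing.Lalgebra_isAlgebra.Build R[i] B bop_scalerAr.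

Lemma bopME S T x : (S * T) x = S (T x). Proof. by []. Qed.
Lemma bopBE S T x : (S - T) x = S x - T x. Proof. by []. Qed.
Lemma bop_starE T x y : '[T x, y] = '[x, bop_star T y].
Proof. exact: (adjP (bopP T)).2. Qed.

Lemma bop_star_unique S T : (forall x y, '[T x, y] = '[x, S y]) -> bop_star T = S.
Proof.
by move=> h; apply: bop_ext => y; apply: inner_inj => x; rewrite -bop_starE h.
Qed.

Lemma bop_starD S T : bop_star (S + T) = bop_star S + bop_star T.
Proof.
apply: bop_star_unique => x y.
by rewrite !bopDE innerDl innerDr !bop_starE.
Qed.

Lemma bop_starZ (a : R[i]) T : bop_star (a *: T) = Num.conj a *: bop_star T.
Proof.
apply: bop_star_unique => x y.
by rewrite !bopZE innerZl innerZr conjCK bop_starE.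
Qed.

Lemma bop_starM S T : bop_star (S * T) = bop_star T * bop_star S.
Proof. by apply: bop_star_unique => x y; rewrite !bopME !bop_starE. Qed.

Lemma bop_starK : involutive bop_star.
Proof.
move=> T; apply: bop_star_unique => x y.
by rewrite innerC -bop_starE -innerC.
Qed.

Definition bop_norm T : R[i] := (opnorm T)%:C.

Lemma bop_norm_ge0 T : 0 <= bop_norm T.
Proof. by rewrite lecR (opnorm_ge0 (bopP T)). Qed.

Lemma bop_norm0_eq0 T : bop_norm T = 0 -> T = 0.
Proof.
move=> /(@complexI R) T0; apply: bop_ext => x; apply/nm0_eq0/le_anti.
by rewrite nm_ge0 andbT (le_trans (opnormP _ (bopP T)))// T0 mul0r.
Qed.

Lemma opnormZ_le (a : R[i]) T : opnorm (a *: T) <= nm a * opnorm T.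
Proof.
apply: opnorm_le => [|x]; first by rewrite mulr_ge0 ?nm_ge0 ?(opnorm_ge0 (bopP T)).
by rewrite bopZE nmZ -mulrA ler_wpM2l ?nm_ge0// (opnormP _ (bopP T)).
Qed.

Lemma bop_normZ (a : R[i]) T : bop_norm (a *: T) = `|a| * bop_norm T.
Proof.
rewrite /bop_norm nmE -rmorphM /=; congr _%:C; apply: le_anti.
rewrite opnormZ_le /=.
have [->|an0] := eqVneq a 0.
  by rewrite nm0 mul0r (opnorm_ge0 (bopP (0 *: T))).
have ap : 0 < nm a.
  by rewrite lt_def nm_ge0 andbT; apply: contra_neq an0 => /nm0_eq0.
have := opnormZ_le a^-1 (a *: T); rewrite scalerA mulVf// scale1r => h.
have -> : opnorm (a *: T) = nm a * (nm a^-1 * opnorm (a *: T)).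
  rewrite mulrA -nmM divff//.
  by rewrite (nmC 1) normr1 mul1r.
by rewrite ler_pM2l.
Qed.

Lemma bop_normD S T : bop_norm (S + T) <= bop_norm S + bop_norm T.
Proof.
rewrite -rmorphD lecR; apply: opnorm_le => [|x].
  by rewrite addr_ge0 ?(opnorm_ge0 (bopP _)).
by rewrite bopDE (le_trans (nmD _ _))// mulrDl lerD ?(opnormP _ (bopP _)).
Qed.

Lemma opnormM S T : opnorm (S * T) <= opnorm S * opnorm T.
Proof.
apply: opnorm_le => [|x]; first by rewrite mulr_ge0 ?(opnorm_ge0 (bopP _)).
rewrite bopME (le_trans (opnormP _ (bopP _)))// -mulrA.
by rewrite ler_wpM2l ?(opnorm_ge0 (bopP _))// (opnormP _ (bopP _)).
Qed.

Lemma bop_normM S T : bop_norm (S * T) <= bop_norm S * bop_norm T.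
Proof. by rewrite -rmorphM lecR opnormM. Qed.

(** From |T x|^2 = <T^*T x, x> <= |T^*T| |x|^2, the square root of |T^*T| is an admissible constant
    for T. *)
Lemma opnorm_sqr_le T : opnorm T ^+ 2 <= opnorm (bop_star T * T).
Proof.
set M := opnorm (bop_star T * T); have M0 : 0 <= M by exact: opnorm_ge0 (bopP _).
have -> : M = Num.sqrt M ^+ 2 by rewrite sqr_sqrtr.
rewrite ler_sqr ?nnegrE ?sqrtr_ge0 ?(opnorm_ge0 (bopP _))//.
apply: opnorm_le => [|x]; first exact: sqrtr_ge0.
rewrite -ler_sqr ?nnegrE ?mulr_ge0 ?nm_ge0 ?sqrtr_ge0// exprMn sqr_sqrtr//.
have -> : nm (T x) ^+ 2 = Re '[(bop_star T * T) x, x].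
  by rewrite bopME bop_starE bop_starK inner_nm.
apply: (le_trans (CauchySchwarz_Re _ _)).
by rewrite expr2 mulrA ler_wpM2r ?nm_ge0// (opnormP _ (bopP _)).
Qed.

Lemma opnorm_star_le T : opnorm T <= opnorm (bop_star T).
Proof.
have [->|n0] := eqVneq (opnorm T) 0; first exact: opnorm_ge0 (bopP _).
have p : 0 < opnorm T by rewrite lt_def n0 (opnorm_ge0 (bopP _)).
rewrite -(ler_pM2r p) -expr2.
by rewrite (le_trans (opnorm_sqr_le _))// opnormM.
Qed.

Lemma bop_norm_starM T : bop_norm (bop_star T * T) = bop_norm T ^+ 2.
Proof.
rewrite /bop_norm.
suff -> : opnorm (bop_star T * T) = opnorm T ^+ 2 by rewrite rmorphXn.
apply: le_anti; rewrite opnorm_sqr_le andbT (le_trans (opnormM _ _))//.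
rewrite expr2 ler_wpM2r ?(opnorm_ge0 (bopP _))//.
by rewrite (le_trans (opnorm_star_le _))// bop_starK.
Qed.

(** Pointwise limits define l; letting one index of the Cauchy estimate tend to infinity gives
    [close], uniform on balls, which carries linearity and boundedness over to l. *)
Lemma bop_norm_complete (u : nat -> B) :
  (forall e, 0 < e -> exists N, forall m n, (N <= m)%N -> (N <= n)%N ->
     bop_norm (u m - u n) < e) ->
  exists l, forall e, 0 < e -> exists N, forall n, (N <= n)%N ->
     bop_norm (u n - l) < e.
Proof.
move=> cu.
have cuR (e : R) : 0 < e -> exists N, forall m n, (N <= m)%N -> (N <= n)%N ->
    forall x, nm (u m x - u n x) <= e * nm x.
  move=> e0; have [|N hN] := cu e%:C; first by rewrite ltcR.
  exists N => m n Nm Nn x; have := hN m n Nm Nn; rewrite ltcR => /ltW h.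
  have := opnormP x (bopP (u m - u n)); rewrite bopBE => /le_trans; apply.
  by rewrite ler_wpM2r ?nm_ge0.
have /choice[l lP] : forall x, exists y, tends_to (u^~ x) y.
  move=> x; apply: (@complete_seq R H (u^~ x)) => e e0.
  have x1 : 0 < nm x + 1 by rewrite ltr_wpDl// nm_ge0.
  have [N hN] := cuR _ (divr_gt0 e0 x1).
  exists N => m n Nm Nn; apply: (le_lt_trans (hN _ _ Nm Nn x)).
  by rewrite mulrAC ltr_pdivrMr// ltr_pM2l// ltrDl.
have close (e : R) : 0 < e -> exists N, forall n, (N <= n)%N ->
    forall x, nm (u n x - l x) <= e * nm x.
  move=> e0; have [N hN] := cuR e e0; exists N => n Nn x.
  apply: le_eps => d d0; have [N' hN'] := lP x d d0.
  have h1 := hN n (maxn N N') Nn (leq_maxl _ _) x.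
  have h2 := hN' (maxn N N') (leq_maxr _ _).
  by rewrite (le_trans (nmB_trans (u (maxn N N') x) _ _))// lerD// ltW.
have lin_l : linear l.
  move=> a x y; apply/eqP; rewrite -subr_eq0; apply/eqP/nm0_eq0/le_anti.
  rewrite nm_ge0 andbT; apply: le_eps => d d0; rewrite add0r.
  (* The weights of the three approximation errors, plus 1 to make K positive. *)
  set K := nm (a *: x + y) + nm a * nm x + nm y + 1.
  have K0 : 0 < K by rewrite ltr_wpDl// !addr_ge0 ?mulr_ge0 ?nm_ge0.
  have [N hN] := close _ (divr_gt0 d0 K0).
  have h z : nm (l z - u N z) <= d / K * nm z by rewrite nmBC hN.
  have -> : l (a *: x + y) - (a *: l x + l y) =
    (l (a *: x + y) - u N (a *: x + y)) - (a *: (l x - u N x) + (l y - u N y)).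
    rewrite (bopP (u N)).1 scalerBr [X in _ = _ - X]addrACA -opprD opprB.
    by rewrite addrA subrK.
  apply: (le_trans (nmD _ _)); rewrite nmN.
  apply: (@le_trans _ _ (d / K * nm (a *: x + y) + (nm a * (d / K * nm x) + d / K * nm y))).
    rewrite lerD ?h// (le_trans (nmD _ _))// lerD ?h// nmZ.
    by rewrite ler_wpM2l ?nm_ge0 ?h.
  have -> : d / K * nm (a *: x + y) + (nm a * (d / K * nm x) + d / K * nm y)
    = d / K * (K - 1) by rewrite /K; ring.
  by rewrite mulrBr mulr1 divfK ?gt_eqF// lerBlDr lerDl divr_ge0// ltW.
have bl : bounded_op l.
  apply/bounded_opP; split=> //; have [N hN] := close 1 ltr01.
  exists (1 + opnorm (u N)); split=> [|x]; first by rewrite addr_ge0 ?(opnorm_ge0 (bopP _)).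
  rewrite -[l x](subrK (u N x)) (le_trans (nmD _ _))// mulrDl.
  by rewrite lerD ?(opnormP _ (bopP _))// nmBC hN.
exists (bop_of bl) => e e0; have er : 0 < Re e / 2 by rewrite divr_gt0 ?gt0_Re.
have [N hN] := close _ er; exists N => n Nn.
rewrite (ge0_ReE (ltW e0)) ltcR.
apply: (@le_lt_trans _ _ (Re e / 2)).
  by apply: opnorm_le => [|x]; [exact: ltW|rewrite bopBE hN].
by rewrite ltr_pdivrMr// ltr_pMr ?gt0_Re// ltr1n.
Qed.

HB.instance Definition _ := isCStarAlgebra.Build R[i] B
  bop_starD bop_starZ bop_starM bop_starK bop_norm_ge0 bop_norm0_eq0
  bop_normZ bop_normD bop_normM bop_norm_starM bop_norm_complete.

Lemma starE T x y : '[T x, y] = '[x, star T y].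
Proof. exact: bop_starE. Qed.

End BoundedOperatorsAlgebra.

(** * The Hilbert space l^2(N) *)

Section Sums.
Variable R : realType.
Implicit Types (f g : nat -> R[i]) (l : R[i]).

Definition sums_to f l := tends_to (fun n => \sum_(k < n) f k) l.

Lemma sums_unique f l l' : sums_to f l -> sums_to f l' -> l = l'.
Proof. exact: tends_unique. Qed.

Lemma sums_to_lin a f g l l' : sums_to f l -> sums_to g l' ->
  sums_to (fun k => a * f k + g k) (a * l + l').
Proof.
move=> fl gl'; have := tends_to_lin a fl gl'.
by congr tends_to; apply/funext => n; rewrite mulr_sumr -big_split.
Qed.

Lemma sums_conj f l : sums_to f l -> sums_to (fun k => Num.conj (f k)) (Num.conj l).
Proof.
move=> fl e /fl[N hN]; exists N => n /hN.
by rewrite -rmorph_sum -rmorphB nm_conj.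
Qed.

(** Once a partial sum of the norms is within e of their supremum, every later block of f has norm
    below e. *)
Lemma sums_exists f (M : R) :
  (forall n, \sum_(k < n) nm (f k) <= M) -> exists l, sums_to f l.
Proof.
move=> fM; apply: complete_complex => e e0.
pose S n := \sum_(k < n) nm (f k).
have hs : has_sup (range S).
  by split; [exists (S 0%N), 0%N|exists M => _ [n _ <-]; exact: fM].
have [_ [N _ <-] hN] := sup_adherent e0 hs.
have close m n : (N <= m)%N -> (m <= n)%N ->
    nm (\sum_(k < m) f k - \sum_(k < n) f k) < e.
  move=> Nm mn; rewrite nmBC -!(big_mkord xpredT) (@big_cat_nat _ _ _ m 0 n)//=.
  rewrite addrAC subrr add0r (le_lt_trans (nm_sum _ _))//.
  have Sn : S n <= sup (range S) by apply: ub_le_sup; [exact: hs.2|exists n].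
  have SN : S N <= S m.
    rewrite /S -!(big_mkord xpredT (fun k => nm (f k))) (@big_cat_nat _ _ _ N 0 m)//=.
    by rewrite lerDl sumr_ge0// => k _; exact: nm_ge0.
  have : S n = S m + \sum_(m <= k < n) nm (f k).
    by rewrite /S -!(big_mkord xpredT (fun k => nm (f k))) (@big_cat_nat _ _ _ m 0 n).
  move: Sn SN hN; move: (S n) (S m) (S N) (sup _) => a b c d; lra.
exists N => m n Nm Nn; have [mn|/ltnW nm'] := leqP m n; first exact: close.
by rewrite nmBC close.
Qed.

End Sums.

Section SquareSummable.
Variable R : realType.
Implicit Types (f g : nat -> R[i]).

Definition sqsum f n : R := \sum_(k < n) nm (f k : R[i]) ^+ 2.

Definition sqsummable : {pred nat -> R[i]} :=
  fun f => `[< exists M, forall n, sqsum f n <= M >].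

(** The defect is at least (t |z| - |w|)^2 / t. The parameter t stays free: t = 1 gives closure of
    l^2 under sums, and a t adapted to two sequences gives the triangle inequality. *)
Lemma nm_sqrD_le (t : R) (z w : R[i]) : 0 < t ->
  nm (z + w) ^+ 2 <= (1 + t) * nm z ^+ 2 + (1 + t^-1) * nm w ^+ 2.
Proof.
move=> t0; apply: (@le_trans _ _ ((nm z + nm w) ^+ 2)).
  by rewrite ler_sqr ?nnegrE ?addr_ge0 ?nm_ge0// nmD.
rewrite -subr_ge0.
have -> : (1 + t) * nm z ^+ 2 + (1 + t^-1) * nm w ^+ 2 - (nm z + nm w) ^+ 2
   = t^-1 * (t * nm z - nm w) ^+ 2 by field; rewrite gt_eqF.
by rewrite mulr_ge0 ?sqr_ge0// invr_ge0 ltW.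
Qed.

Lemma sqsumD f g n : sqsum (f + g) n <= 2 * sqsum f n + 2 * sqsum g n.
Proof.
rewrite /sqsum !mulr_sumr -big_split /=; apply: ler_sum => k _.
apply: (le_trans (nm_sqrD_le _ _ ltr01)); rewrite invr1; lra.
Qed.

Lemma sqsumZ (a : R[i]) f n : sqsum (a *: f) n = nm a ^+ 2 * sqsum f n.
Proof.
rewrite /sqsum mulr_sumr; apply: eq_bigr => k _.
by rewrite scalrfctE -exprMn -nmM.
Qed.

Lemma sqsumN f n : sqsum (- f) n = sqsum f n.
Proof. by apply: eq_bigr => k _; rewrite opprfctE nmN. Qed.

Lemma sqsummable_closed : subsemimod_closed sqsummable.
Proof.
split; first split.
- apply/asboolP; exists 0 => n; rewrite /sqsum big1// => k _.
  by rewrite nm0 expr0n.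
- move=> f g /asboolP[M fM] /asboolP[M' gM']; apply/asboolP.
  exists (2 * M + 2 * M') => n; rewrite (le_trans (sqsumD _ _ _))//.
  by rewrite lerD// ler_wpM2l.
- move=> a f /asboolP[M fM]; apply/asboolP; exists (nm a ^+ 2 * M) => n.
  by rewrite sqsumZ ler_wpM2l// sqr_ge0.
Qed.

HB.instance Definition _ :=
  GRing.isSubmodClosed.Build R[i] (nat -> R[i]) sqsummable sqsummable_closed.

Record ell2 := Ell2 { ell2_val :> nat -> R[i]; ell2_valP : ell2_val \in sqsummable }.

HB.instance Definition _ := [isSub for ell2_val].
HB.instance Definition _ := [Choice of ell2 by <:].
HB.instance Definition _ := [SubChoice_isSubLmodule of ell2 by <:].

Implicit Types u v w : ell2.

(** The default 0 is never taken: the series converges absolutely because |a b| <= a^2 + b^2. *)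
Definition ell2_inner u v : R[i] :=
  xget 0 [set l | sums_to (fun k => u k * Num.conj (v k)) l].
Local Notation "''[' u , v ]" := (ell2_inner u v).

Lemma ell2P u : exists M, forall n, sqsum u n <= M.
Proof. exact/asboolP/ell2_valP. Qed.

Lemma ell2_innerP u v : sums_to (fun k => u k * Num.conj (v k)) '[u, v].
Proof.
have [M uM] := ell2P u; have [M' vM'] := ell2P v.
apply: (@xgetPex _ 0 [set l | sums_to _ l]); apply: (@sums_exists _ _ (M + M')) => n.
apply: le_trans (lerD (uM n) (vM' n)); rewrite /sqsum -big_split /=.
apply: ler_sum => k _; rewrite nmM nm_conj.
by move: (nm _) (nm _) => a b; have := sqr_ge0 (a - b); nra.
Qed.

Lemma ell2_innerPl a u v w : '[a *: u + v, w] = a * '[u, w] + '[v, w].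
Proof.
apply: (sums_unique (ell2_innerP _ _)).
have := sums_to_lin a (ell2_innerP u w) (ell2_innerP v w).
congr sums_to; apply/funext => k /=.
by rewrite mulrA -mulrDl.
Qed.

Lemma ell2_innerC u v : '[u, v] = Num.conj '[v, u].
Proof.
apply: (sums_unique (ell2_innerP _ _)).
have := sums_conj (ell2_innerP v u).
by congr sums_to; apply/funext => k /=; rewrite rmorphM /= conjCK mulrC.
Qed.

Lemma ell2_innerPr a w u v :
  '[w, a *: u + v] = Num.conj a * '[w, u] + '[w, v].
Proof.
by rewrite ell2_innerC ell2_innerPl rmorphD rmorphM /= -!ell2_innerC.
Qed.

Lemma sqsum_sums u n : \sum_(k < n) u k * Num.conj (u k) = (sqsum u n)%:C.
Proof.
by rewrite rmorph_sum; apply: eq_bigr => k _; rewrite rmorphXn /= -nmE normCK.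
Qed.

Lemma ell2_inner_self u : '[u, u] = (Re '[u, u])%:C.
Proof.
have := ell2_innerC u u; case: '[u, u] => a b [] /eqP.
by rewrite -addr_eq0 => /eqP h; congr (_ +i* _); lra.
Qed.

Lemma sqsum_le u n : sqsum u n <= Re '[u, u].
Proof.
apply: le_eps => e e0; have [N hN] := ell2_innerP u u e0.
have := hN (maxn N n) (leq_maxl _ _); rewrite nmBC sqsum_sums => h.
have := le_lt_trans (le_trans (ler_norm _) (Re_le_nm _)) h.
have : sqsum u n <= sqsum u (maxn N n).
  rewrite /sqsum -!(big_mkord xpredT (fun k => nm (u k : R[i]) ^+ 2)).
  rewrite (@big_cat_nat _ _ _ n 0 (maxn N n)) ?leq_maxr//=.
  by rewrite lerDl sumr_ge0// => k _; rewrite sqr_ge0.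
have := hN (maxn N n) (leq_maxl _ _); rewrite sqsum_sums => h2.
have := le_lt_trans (le_trans (ler_norm _) (Re_le_nm _)) h2.
by rewrite !cReD !cReN /=; lra.
Qed.

Lemma inner_self_le u M : (forall n, sqsum u n <= M) -> Re '[u, u] <= M.
Proof.
move=> uM; apply: le_eps => e e0; have [N hN] := ell2_innerP u u e0.
have := hN N (leqnn _); rewrite nmBC sqsum_sums => h.
have := le_lt_trans (le_trans (ler_norm _) (Re_le_nm _)) h.
by rewrite !cReD !cReN /=; have := uM N; lra.
Qed.

Lemma nm_coord_le u k : nm (u k : R[i]) ^+ 2 <= Re '[u, u].
Proof.
apply: (le_trans _ (sqsum_le u k.+1)).
by rewrite /sqsum big_ord_recr /= lerDr sumr_ge0// => j _; rewrite sqr_ge0.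
Qed.

Definition ell2_norm u : R := Num.sqrt (Re '[u, u]).

Lemma ell2_norm_ge0 u : 0 <= ell2_norm u. Proof. exact: sqrtr_ge0. Qed.

Lemma ell2_norm_sqr u : ell2_norm u ^+ 2 = Re '[u, u].
Proof. by rewrite sqr_sqrtr// (le_trans _ (sqsum_le u 0))// /sqsum big_ord0. Qed.

Lemma ell2_norm_le u M : 0 <= M -> (forall n, sqsum u n <= M ^+ 2) -> ell2_norm u <= M.
Proof.
move=> M0 h; rewrite -ler_sqr ?nnegrE ?ell2_norm_ge0// ell2_norm_sqr.
exact: inner_self_le.
Qed.

Lemma sqsum_le_norm u n : sqsum u n <= ell2_norm u ^+ 2.
Proof. by rewrite ell2_norm_sqr sqsum_le. Qed.

Lemma ell2_norm0_eq0 u : ell2_norm u = 0 -> u = 0.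
Proof.
move=> u0; apply/val_inj/funext => k /=; apply/nm0_eq0/eqP.
rewrite -sqrf_eq0 eq_le sqr_ge0 andbT.
by have := nm_coord_le u k; rewrite -ell2_norm_sqr u0 expr0n.
Qed.

Lemma ell2_normZ (a : R[i]) u : ell2_norm (a *: u) = nm a * ell2_norm u.
Proof.
apply/eqP; rewrite -(@eqrXn2 _ 2) ?ell2_norm_ge0 ?mulr_ge0 ?ell2_norm_ge0 ?nm_ge0//.
have E : '[a *: u, a *: u] = a * Num.conj a * '[u, u].
  have Z (v w : ell2) b : '[b *: v, w] = b * '[v, w].
    have := ell2_innerPl b v 0 w; rewrite addr0 => ->.
    have := ell2_innerPl (-1) 0 0 w; rewrite scaler0 addr0 mulN1r addNr => ->.
    by rewrite addr0.
  by rewrite Z ell2_innerC Z rmorphM /= -ell2_innerC mulrA.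
rewrite exprMn !ell2_norm_sqr E -normCK nmE -rmorphXn ell2_inner_self.
by rewrite -rmorphM.
Qed.

(* (a + b)^2 <= (1 + t) a^2 + (1 + 1/t) b^2 with t = |v| / |u|. *)
Lemma ell2_normD u v : ell2_norm (u + v) <= ell2_norm u + ell2_norm v.
Proof.
have [/ell2_norm0_eq0->|u0] := eqVneq (ell2_norm u) 0.
  by rewrite add0r lerDr ell2_norm_ge0.
have [/ell2_norm0_eq0->|v0] := eqVneq (ell2_norm v) 0.
  by rewrite addr0 lerDl ell2_norm_ge0.
have up : 0 < ell2_norm u by rewrite lt_def u0 ell2_norm_ge0.
have vp : 0 < ell2_norm v by rewrite lt_def v0 ell2_norm_ge0.
apply: ell2_norm_le => [|n]; first by rewrite addr_ge0 ?ell2_norm_ge0.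
set p := ell2_norm u; set q := ell2_norm v; pose t := q / p.
have t0 : 0 < t by rewrite divr_gt0.
have -> : (p + q) ^+ 2 = (1 + t) * p ^+ 2 + (1 + t^-1) * q ^+ 2.
  by rewrite /t; field; rewrite u0 v0.
apply: (@le_trans _ _ ((1 + t) * sqsum u n + (1 + t^-1) * sqsum v n)).
  rewrite /sqsum !mulr_sumr -big_split /=; apply: ler_sum => k _.
  exact: nm_sqrD_le.
by rewrite lerD// ler_wpM2l ?sqsum_le_norm// addr_ge0 ?invr_ge0// ltW.
Qed.

Lemma ell2_normCD u v :
  (ell2_norm (u + v))%:C <= (ell2_norm u)%:C + (ell2_norm v)%:C.
Proof. by rewrite -rmorphD lecR ell2_normD. Qed.

Lemma ell2_normCZ (a : R[i]) u : (ell2_norm (a *: u))%:C = `|a| * (ell2_norm u)%:C.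
Proof. by rewrite ell2_normZ nmE rmorphM. Qed.

Lemma ell2_normC0_eq0 u : (ell2_norm u)%:C = 0 -> u = 0.
Proof. by move=> /(@complexI R); exact: ell2_norm0_eq0. Qed.

HB.instance Definition _ := @Lmodule_isNormed.Build R[i] ell2
  (fun u => (ell2_norm u)%:C) ell2_normCD ell2_normCZ ell2_normC0_eq0.

Lemma nm_ell2 u : nm u = ell2_norm u. Proof. by []. Qed.

(** The limit l is taken coordinatewise. In [small] the rank depends on the truncation K; going
    through a later term of the Cauchy sequence removes this dependence in [close]. *)
Lemma ell2_seq_complete (u : nat -> ell2) :
  cauchy_sequence u -> exists l, tends_to u l.
Proof.
move=> cu.
have /choice[l lP] : forall k, exists a, tends_to (fun n => u n k : R[i]) a.
  move=> k; apply: complete_complex => e /cu[N hN].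
  exists N => m n Nm Nn; apply: le_lt_trans (hN m n Nm Nn).
  rewrite -ler_sqr ?nnegrE ?nm_ge0// nm_ell2 ell2_norm_sqr.
  exact: (nm_coord_le (u m - u n)).
pose l' : nat -> R[i] := l.
have small K (e : R) : 0 < e ->
    exists N, forall n, (N <= n)%N -> sqsum (ell2_val (u n) - l') K < e.
  elim: K e => [|K IH] e e0; first by exists 0%N => n _; rewrite /sqsum big_ord0.
  have e2 : 0 < e / 2 by rewrite divr_gt0.
  have [N hN] := IH _ e2; have [|N' hN'] := lP K (Num.sqrt (e / 2)).
    by rewrite sqrtr_gt0.
  exists (maxn N N') => n; rewrite geq_max => /andP[Nn N'n].
  rewrite /sqsum big_ord_recr /= (splitr e) ltrD ?hN//.
  have : nm (u n K - l K) ^+ 2 < Num.sqrt (e / 2) ^+ 2.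
    by rewrite ltr_sqr ?nnegrE ?nm_ge0 ?sqrtr_ge0 ?hN'.
  by rewrite sqr_sqrtr// ltW.
have close (e : R) : 0 < e -> exists N, forall n, (N <= n)%N -> forall K,
    sqsum (ell2_val (u n) - l') K <= e ^+ 2.
  move=> e0; have [|N hN] := cu (e / 2); first by rewrite divr_gt0.
  exists N => n Nn K; apply: le_eps => d d0.
  have [|N' hN'] := small K (d / 2); first by rewrite divr_gt0.
  have h := hN n (maxn N N') Nn (leq_maxl _ _).
  have h' := hN' (maxn N N') (leq_maxr _ _).
  have -> : ell2_val (u n) - l' =
      ell2_val (u n - u (maxn N N')) + (ell2_val (u (maxn N N')) - l').
    by rewrite [ell2_val (_ - _)]/(ell2_val _ - ell2_val _) addrA subrK.
  apply: (le_trans (sqsumD _ _ _)).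
  have := sqsum_le_norm (u n - u (maxn N N')) K; rewrite -nm_ell2 => h2.
  have : nm (u n - u (maxn N N')) ^+ 2 <= (e / 2) ^+ 2.
    by rewrite ler_sqr ?nnegrE ?nm_ge0 ?ltW// divr_gt0.
  move: h' h2; move: (sqsum _ _) (sqsum _ _) (nm _) => a b c; nra.
have l_in : l' \in sqsummable.
  have [N hN] := close 1 ltr01; apply/asboolP; have [M hM] := ell2P (u N).
  exists (2 * M + 2) => K.
  have -> : l' = ell2_val (u N) + - (ell2_val (u N) - l') by rewrite opprB addrC subrK.
  rewrite (le_trans (sqsumD _ _ _))// sqsumN lerD// ?ler_wpM2l//.
  by have := hN N (leqnn _) K; lra.
exists (Ell2 l_in) => e e0.
have e2 : 0 < e / 2 by rewrite divr_gt0.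
have [N hN] := close _ e2; exists N => n Nn.
apply: (@le_lt_trans _ _ (e / 2)); last by rewrite ltr_pdivrMr// ltr_pMr// ltr1n.
by apply: ell2_norm_le => [|K]; [exact: ltW|exact: hN].
Qed.

(** A Cauchy filter contains balls of radius 1/(n+1); any two of them meet, so their centres form a
    Cauchy sequence, whose limit is that of the filter. *)
Lemma seq_complete_cvg (V : normedModType R[i]) :
  (forall u : nat -> V, cauchy_sequence u -> exists l, tends_to u l) ->
  forall F : set_system V, ProperFilter F -> cauchy F -> cvg F.
Proof.
move=> hV F FF /cauchyP cF.
have e_gt0 n : 0 < (n.+1%:R^-1 : R)%:C by rewrite ltcR invr_gt0.
have /choice[u uP] := fun n => cF _ (e_gt0 n).
have ballE x (e : R) y : ball x e%:C y <-> nm (x - y) < e.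
  by rewrite -ball_normE /= nmE ltcR.
have [|l lP] := hV u.
  move=> e e0; have [|N hN] := @small_inv _ (e / 2); first by rewrite divr_gt0.
  exists N => m n Nm Nn; have Fmn : F (ball (u m) (m.+1%:R^-1 : R)%:C `&` ball (u n) (n.+1%:R^-1 : R)%:C).
    exact: filterI.
  have [z [/ballE mz /ballE nz]] := filter_ex Fmn.
  rewrite (le_lt_trans (nmB_trans z _ _))// (splitr e) ltrD//.
    by rewrite (lt_trans mz)// hN.
  by rewrite nmBC (lt_trans nz)// hN.
apply/cvg_ex; exists l; apply/cvgrPdist_lt => e e0.
have er : 0 < Re e / 2 by rewrite divr_gt0 ?gt0_Re.
have [N hN] := small_inv er; have [N' hN'] := lP _ er.
apply: filterS (uP (maxn N N')) => z /ballE h.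
rewrite nmE (ge0_ReE (ltW e0)) ltcR (le_lt_trans (nmB_trans (u (maxn N N')) _ _))//.
rewrite (splitr (Re e)) ltrD//; first by rewrite nmBC hN'// leq_maxr.
by rewrite (lt_trans h)// hN// leq_maxl.
Qed.

HB.instance Definition _ :=
  Uniform_isComplete.Build ell2 (seq_complete_cvg ell2_seq_complete).

Lemma ell2_bilinear : bilinear_for
  ( *%R : GRing.Scale.law R[i] R[i]) (Num.conj \; *%R : GRing.Scale.law R[i] R[i])
  ell2_inner.
Proof. by split=> w a u v /=; rewrite ?ell2_innerPl ?ell2_innerPr. Qed.

HB.instance Definition _ := bilinear_isBilinear.Build R[i] ell2 ell2 R[i]
  ( *%R) (Num.conj \; *%R) ell2_inner ell2_bilinear.

Lemma ell2_hermitian u v : '[u, v] = (-1) ^+ false * Num.conj '[v, u].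
Proof. by rewrite mul1r ell2_innerC. Qed.

HB.instance Definition _ := isHermitianSesquilinear.Build R[i] ell2 false Num.conj
  ell2_inner ell2_hermitian.

Lemma ell2_dot u : u != 0 -> 0 < '[u, u].
Proof.
move=> u0; rewrite ell2_inner_self -ell2_norm_sqr ltcR exprn_gt0//.
by rewrite lt_def ell2_norm_ge0 andbT; apply: contra_neq u0 => /ell2_norm0_eq0.
Qed.

HB.instance Definition _ := isDotProduct.Build R[i] ell2 ell2_inner ell2_dot.

Lemma ell2_hilbert_norm u : `|u| ^+ 2 = '[u, u].
Proof. by rewrite ell2_inner_self -ell2_norm_sqr nmE nm_ell2 rmorphXn. Qed.

HB.instance Definition _ := isHilbert.Build R[i] ell2 ell2_hilbert_norm.

End SquareSummable.

(** * States on C*-algebras *)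

Lemma geometric_small (R : realType) (r e : R) : 0 <= r -> r < 1 -> 0 < e ->
  exists N, forall n, (N <= n)%N -> r ^+ n < e.
Proof.
move=> r0 r1 e0.
have /cvgrPdist_lt/(_ e e0)[N _ hN] : (GRing.exp r : R^nat) @ \oo --> (0 : R).
  by apply: cvg_expr; rewrite ger0_norm.
exists N => n Nn; have := hN n Nn.
by rewrite /= sub0r normrN ger0_norm ?exprn_ge0.
Qed.

Section CStarFacts.
Variables (R : realType) (A : cstarAlgType R[i]).
Implicit Types (x y z : A) (a : R[i]).

Definition rnm x : R := Re (cnorm x).

Lemma rnmE x : cnorm x = (rnm x)%:C.
Proof. exact/ge0_ReE/cnorm_ge0. Qed.

Lemma rnm_ge0 x : 0 <= rnm x.
Proof. exact/ge0_Re/cnorm_ge0. Qed.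

Lemma rnm0_eq0 x : rnm x = 0 -> x = 0.
Proof. by move=> x0; apply: cnorm0_eq0; rewrite rnmE x0. Qed.

Lemma rnmZ a x : rnm (a *: x) = nm a * rnm x.
Proof. by apply: (@complexI R); rewrite rmorphM /= -!rnmE cnormZ nmE. Qed.

Lemma rnmD x y : rnm (x + y) <= rnm x + rnm y.
Proof. by rewrite -lecR rmorphD /= -!rnmE cnormD. Qed.

Lemma rnmM x y : rnm (x * y) <= rnm x * rnm y.
Proof. by rewrite -lecR rmorphM /= -!rnmE cnormM. Qed.

Lemma rnm_starM x : rnm (star x * x) = rnm x ^+ 2.
Proof. by apply: (@complexI R); rewrite rmorphXn /= -!rnmE cnorm_starM. Qed.

Lemma rnm0 : rnm 0 = 0.
Proof. by rewrite -(scale0r 0) rnmZ nm0 mul0r. Qed.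

Lemma rnmN x : rnm (- x) = rnm x.
Proof. by rewrite -scaleN1r rnmZ nmN (nmC 1) normr1 mul1r. Qed.

Lemma rnmBC x y : rnm (x - y) = rnm (y - x).
Proof. by rewrite -rnmN opprB. Qed.

Lemma rnmB_trans y x z : rnm (x - z) <= rnm (x - y) + rnm (y - z).
Proof. by rewrite -[x in leLHS](subrK y) -addrA rnmD. Qed.

Lemma star0 : star (0 : A) = 0.
Proof. by rewrite -(scale0r 0) starZ rmorph0 !scale0r. Qed.

Lemma starN x : star (- x) = - star x.
Proof. by rewrite -scaleN1r starZ rmorphN1 scaleN1r. Qed.

Lemma starB x y : star (x - y) = star x - star y.
Proof. by rewrite starD starN. Qed.

Lemma star1 : star (1 : A) = 1.
Proof. by rewrite -[LHS]mulr1 -{2}[1](starK (1 : A)) -starM mulr1 starK. Qed.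

Lemma rnm_star x : rnm (star x) = rnm x.
Proof.
have le y : rnm y <= rnm (star y).
  have [->|n0] := eqVneq (rnm y) 0; first exact: rnm_ge0.
  have p : 0 < rnm y by rewrite lt_def n0 rnm_ge0.
  by rewrite -(ler_pM2r p) -expr2 -rnm_starM rnmM.
by apply: le_anti; rewrite le andbT -{2}[x]starK le.
Qed.

Lemma rnm_isometry x : star x * x = 1 -> rnm x = 1.
Proof.
have r1 : rnm (1 : A) = 1.
  have n0 : rnm (1 : A) != 0.
    by apply: contra_neq (oner_neq0 A) => /rnm0_eq0.
  by apply: (mulfI n0); rewrite mulr1 -expr2 -rnm_starM star1 mulr1.
move=> x1; have := rnm_starM x; rewrite x1 r1 => /esym/eqP.
by rewrite sqrf_eq1 => /orP[/eqP//|/eqP e]; have := rnm_ge0 x; rewrite e; lra.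
Qed.

(* [1 - a] is the square of [1 - y], where y is the fixed point of the
   contraction [y |-> (a + y^2) / 2] of the ball of radius r. *)
Lemma sqrt_one_sub (a : A) (r : R) : star a = a -> rnm a <= r -> r < 1 ->
  exists z, 1 - a = star z * z.
Proof.
move=> sa ar r1; have r0 : 0 <= r by rewrite (le_trans (rnm_ge0 a)).
pose F y := (2^-1 : R)%:C *: (a + y * y).
have h2 : nm (2^-1 : R)%:C = 2^-1 by rewrite nmC ger0_norm// invr_ge0.
have F_ball y : rnm y <= r -> rnm (F y) <= r.
  move=> yr; rewrite rnmZ h2; have := rnmD a (y * y); have := rnmM y y.
  have := rnm_ge0 y; nra.
(* Without commutativity, y^2 - z^2 = y (y - z) + (y - z) z has norm at most 2 r |y - z|, which F
   halves. *)
have F_contr y z : rnm y <= r -> rnm z <= r -> rnm (F y - F z) <= r * rnm (y - z).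
  move=> yr zr; rewrite /F -scalerBr rnmZ h2.
  have -> : a + y * y - (a + z * z) = y * (y - z) + (y - z) * z.
    by rewrite opprD addrACA subrr add0r mulrBr mulrBl addrA subrK.
  have := rnmD (y * (y - z)) ((y - z) * z); have := rnmM y (y - z).
  have := rnmM (y - z) z; have := rnm_ge0 (y - z); nra.
pose u n := iter n F 0.
have u_ball n : rnm (u n) <= r by elim: n => [|n IH]; [rewrite rnm0|exact: F_ball].
have u_star n : star (u n) = u n.
  by elim: n => [|n IH]; [exact: star0|rewrite starZ conjr_real starD starM sa IH].
(* n contractions act on u k - u 0, already of norm at most r < 1, so no geometric series has to be
   summed. *)
have u_cauchy n k : rnm (u (n + k)%N - u n) <= r ^+ n.
  elim: n => [|n IH]; first by rewrite subr0 expr0 (le_trans (u_ball _))// ltW.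
  by rewrite addSn (le_trans (F_contr _ _ _ _))// exprS ler_wpM2l.
have [|l lP] := @cnorm_complete _ A u.
  move=> e e0; have e2 : 0 < Re e / 2 by rewrite divr_gt0 ?gt0_Re.
  have [N hN] := geometric_small r0 r1 e2; exists N => m n Nm Nn.
  rewrite rnmE (ge0_ReE (ltW e0)) ltcR (le_lt_trans (rnmB_trans (u N) _ _))//.
  rewrite (splitr (Re e)) ltrD//; last rewrite rnmBC.
    by rewrite -(subnKC Nm) (le_lt_trans (u_cauchy _ _))// hN.
  by rewrite -(subnKC Nn) (le_lt_trans (u_cauchy _ _))// hN.
have {}lP (e : R) : 0 < e -> exists n, rnm (u n - l) < e /\ rnm (u n.+1 - l) < e.
  move=> e0; have [|N hN] := lP e%:C; first by rewrite ltcR.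
  exists N; split; rewrite -ltcR -rnmE; exact: hN.
have l_ball : rnm l <= r.
  apply: le_eps => e /lP[n [ln _]].
  rewrite -[l](subKr (u n)) (le_trans (rnmD _ _))// rnmN lerD// ?u_ball//.
  by rewrite ltW.
have l_star : star l = l.
  apply/subr0_eq/rnm0_eq0/le_anti; rewrite rnm_ge0 andbT; apply: le_eps => e e0.
  have [|n [ln _]] := lP (e / 2); first by rewrite divr_gt0.
  rewrite add0r (le_trans (rnmB_trans (u n) _ _))// (splitr e) lerD// ltW//.
  by rewrite -u_star -starB rnm_star rnmBC.
have l_fix : F l = l.
  apply/subr0_eq/rnm0_eq0/le_anti; rewrite rnm_ge0 andbT; apply: le_eps => e e0.
  have [|n [ln lSn]] := lP (e / 2); first by rewrite divr_gt0.
  rewrite add0r (le_trans (rnmB_trans (u n.+1) _ _))// (splitr e) lerD// ltW//.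
  rewrite (le_lt_trans (F_contr l (u n) l_ball (u_ball n)))// rnmBC.
  by rewrite (le_lt_trans _ ln)// ler_piMl ?rnm_ge0 ?(ltW r1).
exists (1 - l); rewrite starB star1 l_star.
have e : a + l * l = l + l.
  have := congr1 (fun z => (2 : R)%:C *: z) l_fix.
  rewrite scalerA -rmorphM divff ?pnatr_eq0// scale1r => ->.
  by rewrite (_ : (2 : R)%:C = 1 + 1) ?scalerDl ?scale1r// -[1 + 1]/(2%:R) rmorph_nat.
have -> : a = l + l - l * l by rewrite -e addrK.
by rewrite mulrBl mul1r mulrBr mulr1 !opprB opprD (addrCA (l * l)) -[RHS]addrA.
Qed.

(** * Symmetry, Cauchy-Schwarz and automatic continuity of states *)

Section States.
Variable s : A -> R[i].
Hypothesis st : state s.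

Lemma stateD x y : s (x + y) = s x + s y.
Proof. by case: st => ls _ _; rewrite -{1}[x]scale1r ls mul1r. Qed.

Lemma stateZ a x : s (a *: x) = a * s x.
Proof.
case: st => ls _ _; have s0 : s 0 = 0.
  by have := ls (-1) 0 0; rewrite scaler0 addr0 mulN1r addNr.
by rewrite -[a *: x]addr0 ls s0 addr0.
Qed.

Lemma state0 : s 0 = 0.
Proof. by rewrite -(scale0r 0) stateZ mul0r. Qed.

Lemma stateN x : s (- x) = - s x.
Proof. by rewrite -scaleN1r stateZ mulN1r. Qed.

Lemma stateB x y : s (x - y) = s x - s y.
Proof. by rewrite stateD stateN. Qed.

Lemma state_sum (I : Type) (r : seq I) (P : pred I) (F : I -> A) :
  s (\sum_(i <- r | P i) F i) = \sum_(i <- r | P i) s (F i).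
Proof. exact: (big_morph s stateD state0). Qed.

Lemma state_pos x : 0 <= s (star x * x).
Proof. by case: st. Qed.

Lemma state1 : s 1 = 1.
Proof. by case: st. Qed.

(** Polarization against 1: s((y + 1)^* (y + 1)) is real, so s(y^* ) + s(y) is real; y = x and y = i
    x give both coordinates. *)
Lemma state_star x : s (star x) = Num.conj (s x).
Proof.
have real y : Im (s (star y * y)) = 0.
  by have := state_pos y; rewrite lecE => /andP[/eqP].
have h y : Im (s (star y)) + Im (s y) = 0.
  have := real (y + 1); rewrite starD star1 mulrDl !mulrDr !mul1r mulr1.
  by rewrite !stateD state1 !cImD real /=; lra.
have h1 := h x; have := h ('i%C *: x).
rewrite starZ !stateZ !cImM /=.
case: (s x) h1 => p q /=; case: (s (star x)) => p' q' /= h1 h2.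
by congr (_ +i* _); lra.
Qed.

Lemma state_CauchySchwarz x y :
  nm (s (star x * y)) ^+ 2 <= Re (s (star x * x)) * Re (s (star y * y)).
Proof.
set w := s (star x * y); set p := Re (s (star y * y)); set q := Re (s (star x * x)).
have p0 : 0 <= p by exact/ge0_Re/state_pos.
have q0 : 0 <= q by exact/ge0_Re/state_pos.
(* Positivity at x - t conj(w) y; the factor conj(w) makes both cross terms equal to t |w|^2. *)
have key (t : R) : 0 <= q - 2 * t * nm w ^+ 2 + t ^+ 2 * nm w ^+ 2 * p.
  have h := ge0_Re (state_pos (x - (t%:C * Num.conj w) *: y)).
  have wc : s (star y * x) = Num.conj w by rewrite -state_star starM starK.
  have pE : s (star y * y) = p%:C by rewrite -ge0_ReE ?state_pos.
  have qE : s (star x * x) = q%:C by rewrite -ge0_ReE ?state_pos.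
  move: h; rewrite [X in Re (s X)](_ : _ = star x * x - (t%:C * Num.conj w) *:
    (star x * y) - (t%:C * w) *: (star y * x) +
    (t%:C * w * (t%:C * Num.conj w)) *: (star y * y)); last first.
    rewrite starB starZ rmorphM /= conjr_real conjCK mulrBl !mulrBr.
    move: (t%:C * _) (t%:C * _) => a b.
    by rewrite -!scalerAl -!scalerAr !scalerA opprB addrA addrAC.
  rewrite stateD !stateB !stateZ -/w wc pE qE nm_sqr; congr (is_true (0 <= _)).
  by case: (w) => b c /=; ring.
have [p_0|pn0] := eqVneq p 0.
  have [w0|wn0] := eqVneq (nm w) 0; first by rewrite w0 expr0n mulr_ge0.
  (* For p = 0 the expression is affine in t, and this t brings it down to -1. *)
  have := key ((q + 1) / (2 * nm w ^+ 2)); rewrite p_0 mulr0 addr0.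
  have -> : q - 2 * ((q + 1) / (2 * nm w ^+ 2)) * nm w ^+ 2 = -1.
    by field.
  by rewrite ler0N1.
have pp : 0 < p by rewrite lt_def pn0.
have := key p^-1.
have -> : q - 2 * p^-1 * nm w ^+ 2 + p^-1 ^+ 2 * nm w ^+ 2 * p
  = (q * p - nm w ^+ 2) / p by field.
by rewrite pmulr_lge0 ?invr_gt0// subr_ge0.
Qed.

(** For K > |x^*x| the element 1 - x^*x/K is some z^*z, and s(z^*z) >= 0 reads s(x^*x) <= K. *)
Lemma state_sqr_le x : Re (s (star x * x)) <= rnm x ^+ 2.
Proof.
rewrite -rnm_starM; set h := star x * x; apply: le_eps => e e0.
set K := rnm h + e; have K0 : 0 < K by rewrite ltr_wpDl// rnm_ge0.
have [|||z hz] := @sqrt_one_sub (K^-1%:C *: h) (rnm h / K).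
- by rewrite starZ conjr_real starM starK.
- by rewrite rnmZ nmC ger0_norm ?invr_ge0 ?(ltW K0)// mulrC.
- by rewrite ltr_pdivrMr// mul1r ltrDl.
have := state_pos z; rewrite -hz stateB stateZ state1 => /ge0_Re.
rewrite cReD cReN cReM /= mul0r subr0 subr_ge0 mulrC ler_pdivrMr//.
by rewrite mul1r.
Qed.

Lemma state_le x : nm (s x) <= rnm x.
Proof.
rewrite -ler_sqr ?nnegrE ?nm_ge0 ?rnm_ge0//.
have := state_CauchySchwarz 1 x; rewrite star1 !mul1r state1 mul1r => /le_trans.
by apply; exact: state_sqr_le.
Qed.

End States.

End CStarFacts.

(** * The transfer map on the states of a Cuntz algebra *)

Section CuntzWords.
Variables (R : realType) (A : cstarAlgType R[i]) (d : nat) (v : 'I_d -> A).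
Hypothesis vC : cuntz_isometries v.
Implicit Types (x y z : A) (i j : 'I_d) (mu nu : seq 'I_d) (S : set A).

Lemma cuntz_star i : star (v i) * v i = 1.
Proof. exact: vC.1. Qed.

Lemma cuntz_sum : \sum_i v i * star (v i) = 1.
Proof. exact: vC.2. Qed.

Definition word mu : A := foldr (fun i x => v i * x) 1 mu.

Lemma word_rcons mu i : word (rcons mu i) = word mu * v i.
Proof. by elim: mu => [|j mu IH] /=; rewrite ?mul1r ?mulr1// IH mulrA. Qed.

Lemma word_isometry mu : star (word mu) * word mu = 1.
Proof.
elim: mu => [|i mu IH] /=; first by rewrite star1 mulr1.
by rewrite starM mulrA -[_ * v i]mulrA cuntz_star mulr1.
Qed.

(* The part of the algebra that no state sees; v_i^* v_j is in it for i <> j.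
   (It is zero, but proving this takes spectral theory, which states replace.) *)
Definition negligible x := forall s : A -> R[i], state s ->
  forall y z, s (y * x * z) = 0.

(** With w_k = v_k^* v_j z, the sum of all w_k^* w_k is z^*z, which is already the term k = j. Under
    a state the other terms are nonnegative with sum 0, and Cauchy-Schwarz brings in the left factor
    y. *)
Lemma negligible_orthogonal i j : i != j -> negligible (star (v i) * v j).
Proof.
move=> ij s st y z.
pose w k := star (v k) * v j * z.
have wj : w j = z by rewrite /w cuntz_star mul1r.
have sum_w : \sum_k star (w k) * w k = star z * z.
  transitivity (star z * (star (v j) * (\sum_k v k * star (v k)) * v j) * z).
    rewrite mulr_sumr mulr_suml mulr_sumr mulr_suml; apply: eq_bigr => k _.
    by rewrite /w !starM starK !mulrA.
  by rewrite cuntz_sum mulr1 cuntz_star mulr1.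
have sum_s : \sum_(k | k != j) s (star (w k) * w k) = 0.
  have := congr1 s sum_w; rewrite (bigD1 j)//= wj (stateD st) (state_sum st).
  by move/(canRL (addKr _)); rewrite addNr.
have /eqP wi : s (star (w i) * w i) == 0.
  apply: contraTT isT => h; move: sum_s.
  move=> /eqP; rewrite psumr_eq0; last by move=> k _; exact: state_pos.
  by move=> /allP/(_ i (mem_index_enum _)); rewrite ij (negPf h).
have := state_CauchySchwarz st (star y) (w i); rewrite wi mulr0 starK /w => h.
rewrite -[LHS]/(s (y * (star (v i) * v j) * z)) -mulrA; apply/nm0_eq0/eqP.
by rewrite -sqrf_eq0 eq_le h sqr_ge0.
Qed.

Lemma negligibleMl c x : negligible x -> negligible (c * x).
Proof. by move=> hx s st y z; rewrite mulrA hx. Qed.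

Lemma negligibleMr c x : negligible x -> negligible (x * c).
Proof. by move=> hx s st y z; rewrite mulrA -mulrA hx. Qed.

Lemma negligible_state s x : state s -> negligible x -> s x = 0.
Proof. by move=> st /(_ s st 1 1); rewrite mul1r mulr1. Qed.

(** Stability under negligible summands lets v_i^* v_j with i <> j be treated as 0 when words are
    multiplied. *)
Definition word_closed S := [/\ forall (a : R[i]) x y, S x -> S y -> S (a *: x + y),
  norm_closed S, forall x y, S x -> negligible y -> S (x + y) &
  forall mu nu, S (word mu * star (word nu))].

Lemma norm_closedR S : (forall x, (forall e : R, 0 < e ->
  exists2 y, S y & rnm (x - y) < e) -> S x) -> norm_closed S.
Proof.
move=> h x hx; apply: h => e e0.
have [|y Sy xy] := hx e%:C; first by rewrite ltcR.
by exists y => //; rewrite -ltcR -rnmE.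
Qed.

Lemma norm_closedRP S x : norm_closed S -> (forall e : R, 0 < e ->
  exists2 y, S y & rnm (x - y) < e) -> S x.
Proof.
move=> h hx; apply: h => e e0; have [y Sy xy] := hx _ (gt0_Re e0).
by exists y => //; rewrite rnmE (ge0_ReE (ltW e0)) ltcR.
Qed.

(* The left multipliers of the smallest [word_closed] set form a norm-closed
   star-subalgebra containing the generators, so they are everything. *)
Lemma word_total S : cstar_generates v -> word_closed S -> forall x, S x.
Proof.
move=> gen SC.
pose L x := forall S', word_closed S' -> S' x.
have L_lin (a : R[i]) x y : L x -> L y -> L (a *: x + y).
  by move=> Lx Ly S' S'C; have [h _ _ _] := S'C; apply: h; [exact: Lx|exact: Ly].
have L_word mu nu : L (word mu * star (word nu)) by move=> S' [].
have L_negl x y : L x -> negligible y -> L (x + y).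
  by move=> Lx ny S' S'C; have [_ _ h _] := S'C; apply: h => //; exact: Lx.
have L_closed : norm_closed L.
  move=> x hx S' S'C; have [_ h _ _] := S'C; apply: h => e /hx[y Ly xy].
  by exists y => //; exact: Ly.
have L1 : L 1 by have := L_word [::] [::]; rewrite /= star1 mulr1.
have L0 : L 0 by have := L_lin (-1) _ _ L1 L1; rewrite scaleN1r addNr.
have approx c x : (forall e : R, 0 < e -> exists2 y, L (c * y) & rnm (x - y) < e) ->
    L (c * x).
  move=> hx; apply: norm_closedRP => // e e0.
  have c1 : 0 < rnm c + 1 by rewrite ltr_wpDl// rnm_ge0.
  have [y Ly xy] := hx _ (divr_gt0 e0 c1); exists (c * y) => //.
  rewrite -mulrBr (le_lt_trans (rnmM _ _))//.
  move: xy; rewrite ltr_pdivlMr// mulrC; apply: le_lt_trans.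
  by rewrite ler_wpM2r ?rnm_ge0// lerDl.
(* By minimality of L, left multiplication by c need only be tested on words. *)
have mult c : (forall mu nu, L (c * (word mu * star (word nu)))) ->
    forall x, L x -> L (c * x).
  move=> cL x Lx; apply: (Lx [set z | L (c * z)]); split=> [a y z Ly Lz||y z Ly nz|//].
  - by rewrite /= mulrDr -scalerAr; exact: L_lin.
  - apply: norm_closedR => y hy; apply: approx => e /hy[z Lz yz].
    by exists z.
  - by rewrite /= mulrDr; apply: L_negl => //; exact: negligibleMl.
pose T : set A := [set x | forall y, L y -> L (x * y) /\ L (star x * y)].
have TT : T = setT; last first.
  move=> x; have Tx : T x by rewrite TT.
  by have [h _] := Tx 1 L1; rewrite mulr1 in h; exact: h.
apply: gen.
- split=> [y Ly|a x y Tx Ty z Lz|x y Tx Ty z Lz|x Tx z Lz].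
  + by rewrite star1 mul1r.
  + rewrite starD starZ !mulrDl -!scalerAl.
    by split; apply: L_lin; apply Tx || apply Ty.
  + rewrite starM -!mulrA; split.
      by apply: (Tx _ _).1; apply: (Ty _ _).1.
    by apply: (Ty _ _).2; apply: (Tx _ _).2.
  + by rewrite starK; have [] := Tx z Lz.
- apply: norm_closedR => x hx z Lz; split; apply: norm_closedRP => // e e0.
  + have z1 : 0 < rnm z + 1 by rewrite ltr_wpDl// rnm_ge0.
    have [y Ty xy] := hx _ (divr_gt0 e0 z1); exists (y * z); first exact: (Ty z Lz).1.
    rewrite -mulrBl (le_lt_trans (rnmM _ _))//.
    move: xy; rewrite ltr_pdivlMr//; apply: le_lt_trans.
    by rewrite ler_wpM2l ?rnm_ge0// lerDl.
  + have z1 : 0 < rnm z + 1 by rewrite ltr_wpDl// rnm_ge0.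
    have [y Ty xy] := hx _ (divr_gt0 e0 z1); exists (star y * z); first exact: (Ty z Lz).2.
    rewrite -mulrBl -starB (le_lt_trans (rnmM _ _))// rnm_star.
    move: xy; rewrite ltr_pdivlMr//; apply: le_lt_trans.
    by rewrite ler_wpM2l ?rnm_ge0// lerDl.
- move=> i y Ly; split; apply: mult => // mu nu; first by rewrite mulrA; exact: (L_word (i :: mu)).
  (* v_i^* is absorbed by the starred word when [mu] is empty; otherwise it meets the first letter
     j, cancelling it if j = i and leaving a negligible product if not. *)
  case: mu => [|j mu] /=.
    by rewrite mul1r -starM -word_rcons -[star _]mul1r; exact: (L_word [::]).
  rewrite !mulrA; have [->|ij] := eqVneq i j.
    by rewrite cuntz_star mul1r; exact: L_word.
  rewrite -[X in L X]add0r; apply: L_negl => //.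
  by do 2![apply: negligibleMr]; exact: negligible_orthogonal.
Qed.

End CuntzWords.

(** * The KMS-type condition as a fixed-point equation *)

Section Transfer.
Variables (R : realType) (d : nat) (alpha : 'I_d -> R).
Hypothesis d_ge2 : (2 <= d)%N.
Hypothesis alphaP : schmidt_coefficients alpha.
Variables (A : cstarAlgType R[i]) (v : 'I_d -> A).
Hypothesis vC : cuntz_isometries v.
Implicit Types (x y z : A) (i j : 'I_d) (mu nu : seq 'I_d) (s t : A -> R[i]).
Local Notation word := (word v).

Definition transfer s x : R[i] := \sum_i (alpha i)%:C ^+ 2 * s (star (v i) * x * v i).

Lemma alpha_sum : \sum_i (alpha i)%:C ^+ 2 = 1 :> R[i].
Proof.
case: alphaP => _ _ h; rewrite -(rmorph1 (real_complex R)) -h rmorph_sum.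
by apply: eq_bigr => i _; rewrite rmorphXn.
Qed.

Lemma transfer_state s : state s -> state (transfer s).
Proof.
move=> st; split.
- move=> a x y; rewrite /transfer mulr_sumr -big_split; apply: eq_bigr => i _ /=.
  rewrite mulrDr mulrDl -scalerAr -scalerAl (stateD st) (stateZ st).
  by rewrite mulrDr mulrCA.
- move=> x; apply: sumr_ge0 => i _; apply: mulr_ge0.
    by rewrite -rmorphXn ler0c sqr_ge0.
  have -> : star (v i) * (star x * x) * v i = star (x * v i) * (x * v i).
    by rewrite starM !mulrA.
  exact: state_pos.
- rewrite /transfer -alpha_sum; apply: eq_bigr => i _.
  by rewrite mulr1 (cuntz_star vC) (state1 st) mulr1.
Qed.

Lemma iter_transfer_state s n : state s -> state (iter n transfer s).
Proof. by move=> st; elim: n => //= n; exact: transfer_state. Qed.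

(** Relates two consecutive iterates: it strips letters along the iteration, and in the limit
    becomes the KMS-type condition. *)
Lemma transfer_kms s : state s -> forall x i j,
  transfer s (v i * x * star (v j)) = (i == j)%:R * (alpha i)%:C ^+ 2 * s x.
Proof.
move=> st x i j; rewrite /transfer (bigD1 i)//= big1 ?addr0 => [|k ki]; last first.
  rewrite -[star _ * _]mul1r.
  have -> : 1 * (star (v k) * (v i * x * star (v j))) * v k =
    1 * (star (v k) * v i) * (x * star (v j) * v k) by rewrite !mulrA.
  by rewrite (negligible_orthogonal vC)// mulr0.
have [->|ij] := eqVneq i j.
  rewrite mul1r !mulrA (cuntz_star vC) mul1r -mulrA (cuntz_star vC) mulr1.
  by [].
have -> : star (v i) * (v i * x * star (v j)) * v i =
    x * (star (v j) * v i) * 1.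
  by rewrite !mulrA (cuntz_star vC) mul1r mulr1.
by rewrite (negligible_orthogonal vC) 1?eq_sym// mulr0 !mul0r.
Qed.

(** Insert the sum of v_i v_i^* on both sides of x; the condition kills the off-diagonal terms. *)
Lemma kms_transfer s : state s -> cuntz_kms alpha v s -> transfer s = s.
Proof.
move=> st sK; apply/funext => x.
rewrite -[in RHS](mul1r x) -[in RHS](mulr1 (1 * x)) -(cuntz_sum vC).
rewrite !mulr_suml (state_sum st); apply: eq_bigr => i _.
rewrite mulr_sumr (state_sum st) (bigD1 i)//= big1 ?addr0 => [|k ki].
  have -> : v i * star (v i) * x * (v i * star (v i)) =
      v i * (star (v i) * x * v i) * star (v i) by rewrite !mulrA.
  by rewrite sK eqxx mul1r.
have -> : v i * star (v i) * x * (v k * star (v k)) =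
    v i * (star (v i) * x * v k) * star (v k) by rewrite !mulrA.
by rewrite sK eq_sym (negPf ki) !mul0r.
Qed.

Let q : R := (alpha (Ordinal (ltnW d_ge2))) ^+ 2.

Lemma alpha_sqr_le i : alpha i ^+ 2 <= q.
Proof.
case: alphaP => mono pos _; rewrite ler_sqr ?nnegrE ?(ltW (pos _))//.
exact: mono.
Qed.

Lemma q_ge0 : 0 <= q. Proof. exact: sqr_ge0. Qed.

(** As d >= 2, a second positive weight keeps the first one below the total 1. *)
Lemma q_lt1 : q < 1.
Proof.
case: alphaP => _ pos <-; pose i1 := Ordinal d_ge2.
rewrite (bigD1 (Ordinal (ltnW d_ge2)))//= ltrDl (bigD1 i1)//= ltr_pwDl//.
  by rewrite exprn_gt0.
by rewrite sumr_ge0// => i _; exact: sqr_ge0.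
Qed.

Lemma iter_transfer_word s n mu : state s -> mu != [::] ->
  nm (iter n transfer s (word mu)) <= q ^+ n.
Proof.
move=> st; elim: n mu => [|n IH] [//|i mu] _.
  by rewrite expr0 -(rnm_isometry (word_isometry vC (i :: mu))) /=; exact: state_le.
have sn := iter_transfer_state n st.
have -> : iter n.+1 transfer s (word (i :: mu)) =
    (alpha i)%:C ^+ 2 * iter n transfer s (word (rcons mu i)).
  (* Inserting the sum of v_k v_k^* on the right provides the starred letter that [transfer_kms]
     strips; only k = i survives, and v_i reappears at the end of the word. *)
  rewrite iterS /= -[v i * _]mulr1 -(cuntz_sum vC) mulr_sumr.
  rewrite (state_sum (transfer_state sn)) (bigD1 i)//= big1 ?addr0 => [|k ki].
    rewrite mulrA -[v i * _ * v i]mulrA (transfer_kms sn) eqxx mul1r.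
    by rewrite word_rcons.
  rewrite mulrA -[v i * _ * v k]mulrA (transfer_kms sn) eq_sym (negPf ki).
  by rewrite !mul0r.
rewrite nmM -rmorphXn nmC ger0_norm ?sqr_ge0// [q ^+ _]exprS.
apply: ler_pM; rewrite ?sqr_ge0 ?nm_ge0 ?alpha_sqr_le//.
by apply: IH; rewrite -size_eq0 size_rcons.
Qed.

(** Uniformity in the states serves existence: a state compared with its own iterates shows that the
    orbit is Cauchy. *)
Definition merging x := forall e : R, 0 < e -> exists N, forall n, (N <= n)%N ->
  forall s t, state s -> state t ->
    nm (iter n transfer s x - iter n transfer t x) < e.

Lemma merging_lin (a : R[i]) x y : merging x -> merging y -> merging (a *: x + y).
Proof.
move=> mx my e e0.
have K0 : 0 < nm a + 1 by rewrite ltr_wpDl// nm_ge0.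
have e2 : 0 < e / 2 by rewrite divr_gt0.
have [N hN] := mx _ (divr_gt0 e2 K0); have [N' hN'] := my _ e2.
exists (maxn N N') => n; rewrite geq_max => /andP[Nn N'n] s t ss st.
have sn := iter_transfer_state n ss; have tn := iter_transfer_state n st.
rewrite (stateD sn) (stateZ sn) (stateD tn) (stateZ tn).
rewrite opprD addrACA -mulrBr (le_lt_trans (nmD _ _))//.
rewrite (splitr e) ler_ltD ?hN'// nmM.
have := hN n Nn s t ss st; rewrite ltr_pdivlMr// => /ltW; apply: le_trans.
by rewrite mulrC ler_wpM2l ?nm_ge0// lerDl.
Qed.

Lemma merging_norm_closed : norm_closed merging.
Proof.
apply: norm_closedR => x hx e e0.
have e3 : 0 < e / 3 by rewrite divr_gt0.
have [y my xy] := hx _ e3; have [N hN] := my _ e3.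
exists N => n Nn s t ss st.
have sn := iter_transfer_state n ss; have tn := iter_transfer_state n st.
have h1 := le_lt_trans (state_le sn (x - y)) xy.
have h2 := le_lt_trans (state_le tn (x - y)) xy.
rewrite (stateB sn) in h1; rewrite (stateB tn) nmBC in h2.
have h3 := hN n Nn s t ss st.
have := nmB_trans (iter n transfer s y) (iter n transfer s x) (iter n transfer t x).
have := nmB_trans (iter n transfer t y) (iter n transfer s y) (iter n transfer t x).
lra.
Qed.

Lemma merging_negligible x y : merging x -> negligible y -> merging (x + y).
Proof.
move=> mx ny e /mx[N hN]; exists N => n Nn s t ss st.
have sn := iter_transfer_state n ss; have tn := iter_transfer_state n st.
rewrite (stateD sn) (stateD tn) (negligible_state sn ny) (negligible_state tn ny) !addr0.
exact: hN.
Qed.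

Lemma merging_star x : merging x -> merging (star x).
Proof.
move=> mx e /mx[N hN]; exists N => n Nn s t ss st.
have sn := iter_transfer_state n ss; have tn := iter_transfer_state n st.
by rewrite (state_star sn) (state_star tn) -rmorphB nm_conj hN.
Qed.

Lemma merging_conj x i j : merging x -> merging (v i * x * star (v j)).
Proof.
(* One more iteration is spent on stripping the outer letters. *)
move=> mx e /mx[N hN]; exists N.+1 => -[//|n] Nn s t ss st.
have sn := iter_transfer_state n ss; have tn := iter_transfer_state n st.
rewrite !iterS !transfer_kms// -mulrBr nmM.
apply: le_lt_trans (hN n Nn s t ss st); rewrite ler_piMl ?nm_ge0// nmM.
rewrite -rmorphXn nmC ger0_norm ?sqr_ge0//.
rewrite mulr_ile1 ?nm_ge0 ?sqr_ge0//.
  by case: (i == j); rewrite ?nm0 ?ler01// (nmC 1) normr1.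
by rewrite (le_trans (alpha_sqr_le i))// ltW// q_lt1.
Qed.

Lemma merging_word mu : merging (word mu).
Proof.
move=> e e0; case: (eqVneq mu [::]) => [->|mu0].
  exists 0%N => n _ s t ss st.
  rewrite /= (state1 (iter_transfer_state n ss)) (state1 (iter_transfer_state n st)).
  by rewrite subrr nm0.
have e2 : 0 < e / 2 by rewrite divr_gt0.
have [N hN] := geometric_small q_ge0 q_lt1 e2; exists N => n Nn s t ss st.
rewrite (le_lt_trans (nmD _ _))// nmN (splitr e).
by rewrite ltrD// (le_lt_trans (iter_transfer_word _ _ _))// hN.
Qed.

Lemma merging_words mu nu : merging (word mu * star (word nu)).
Proof.
elim: mu nu => [|i mu IH] nu.
  by rewrite mul1r; apply: merging_star; exact: merging_word.
case: nu => [|j nu]; first by rewrite /= star1 mulr1; exact: (merging_word (i :: mu)).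
by rewrite /= starM mulrA -[_ * star (word nu)]mulrA; exact: merging_conj.
Qed.

Lemma merging_all x : cstar_generates v -> merging x.
Proof.
move=> gen; apply: (word_total vC gen); split.
- exact: merging_lin.
- exact: merging_norm_closed.
- exact: merging_negligible.
- exact: merging_words.
Qed.

Lemma kms_unique s t : cstar_generates v -> state s -> cuntz_kms alpha v s ->
  state t -> cuntz_kms alpha v t -> s = t.
Proof.
move=> gen ss sK st tK; apply/funext => x.
apply/subr0_eq/nm0_eq0/le_anti; rewrite nm_ge0 andbT; apply: le_eps => e e0.
have [N hN] := merging_all x gen e0; rewrite add0r ltW//.
have fix_iter u n : transfer u = u -> iter n transfer u = u.
  by move=> h; elim: n => //= n ->.
have := hN N (leqnn _) s t ss st.
by rewrite !fix_iter //; exact: kms_transfer.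
Qed.

Lemma kms_exists s0 : cstar_generates v -> state s0 ->
  exists s, state s /\ cuntz_kms alpha v s.
Proof.
move=> gen st0; pose u n := iter n transfer s0.
have uS n : state (u n) by exact: iter_transfer_state.
have /choice[s sP] : forall x, exists l, tends_to (u^~ x) l.
  move=> x; apply: complete_complex => e /(merging_all x gen)[N hN].
  (* Both terms are N-th iterates, started from the states [u (m - N)] and [u (n - N)]. *)
  exists N => m n Nm Nn; rewrite /u -(subnKC Nm) -(subnKC Nn) !iterD.
  by apply: hN => //; exact: iter_transfer_state.
exists s; split; first split.
- move=> a x y; apply: (tends_unique (sP (a *: x + y))).
  have := tends_to_lin a (sP x) (sP y); congr tends_to; apply/funext => n.
  by rewrite (stateD (uS n)) (stateZ (uS n)).
- move=> x; have re e : 0 < e -> exists n, nm (u n (star x * x) - s (star x * x)) < e.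
    by move=> e0; have [N hN] := sP (star x * x) e e0; exists N; exact: hN.
  rewrite lecE /=; apply/andP; split.
    apply/eqP/normr0_eq0/le_anti; rewrite normr_ge0 andbT; apply: le_eps => e /re[n h].
    have := le_lt_trans (Im_le_nm _) h; rewrite cImD cImN.
    have := state_pos (uS n) x; rewrite lecE => /andP[/eqP -> _] /=.
    by rewrite add0r normrN add0r => /ltW.
  rewrite -oppr_le0; apply: le_eps => e /re[n h].
  have := le_lt_trans (le_trans (ler_norm _) (Re_le_nm _)) h; rewrite cReD cReN.
  by have := ge0_Re (state_pos (uS n) x); lra.
- apply: (tends_unique (sP 1)) => e e0; exists 0%N => n _.
  by rewrite (state1 (uS n)) subrr nm0.
move=> x i j; apply: (tends_unique (sP (v i * x * star (v j)))) => e e0.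
have lim0 : tends_to (fun=> 0 : R[i]) 0.
  by move=> e' e'0; exists 0%N => n _; rewrite subrr nm0.
have [N hN] := tends_to_lin ((i == j)%:R * (alpha i)%:C ^+ 2) (sP x) lim0 e0.
exists N.+1 => -[//|n] Nn.
by have := hN n Nn; rewrite !addr0 /u iterS (transfer_kms (uS n)).
Qed.

End Transfer.

(** * Shift isometries and existence of a state *)

Section Spread.
Variables (R : realType) (d : nat) (i : 'I_d).

(* The number of k < n congruent to i modulo d. *)
Let c n := (n %/ d + (i < n %% d))%N.

Let d_gt0 : (0 < d)%N. Proof. exact: leq_ltn_trans (ltn_ord i). Qed.

Lemma spread_count n : (c n.+1 = c n + (n %% d == i))%N.
Proof.
have r_lt : (n %% d < d)%N by rewrite ltn_pmod.
have dvdE : (d %| n.+1)%N = ((n %% d).+1 == d).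
  rewrite {1}(divn_eq n d) -addnS dvdn_addr ?dvdn_mull//.
  have [->|nd] := eqVneq (n %% d).+1 d; first exact: dvdnn.
  by apply: gtnNdvd => //; rewrite ltn_neqAle nd.
rewrite /c divnS// modnS dvdE; have := ltn_ord i.
case: eqP => [e|_]; case: ltngtP; rewrite ?ltn0 ?ltnS; lia.
Qed.

(** Partial sums of the spread sequence are partial sums of f, so bounds and limits transfer without
    rearranging a series. *)
Lemma spread_sum (V : nmodType) (f : nat -> V) n :
  \sum_(k < n) (if (k %% d == i)%N then f (k %/ d)%N else 0) = \sum_(j < c n) f j.
Proof.
elim: n => [|n IH]; first by rewrite /c div0n mod0n ltn0 !big_ord0.
rewrite big_ord_recr /= IH spread_count; case: eqP => [e|_].
  have -> : c n = (n %/ d)%N by rewrite /c e ltnn addn0.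
  by rewrite addn1 big_ord_recr.
by rewrite addn0 addr0.
Qed.

Definition spread (f : nat -> R[i]) : nat -> R[i] :=
  fun k => if (k %% d == i)%N then f (k %/ d)%N else 0.

Definition unspread (f : nat -> R[i]) : nat -> R[i] := fun j => f (j * d + i)%N.

Lemma spread_lin (a : R[i]) f g k :
  spread (fun k => a * f k + g k) k = a * spread f k + spread g k.
Proof. by rewrite /spread; case: ifP => // _; rewrite mulr0 addr0. Qed.

Lemma spreadK f : unspread (spread f) = f.
Proof.
apply/funext => j; rewrite /unspread /spread modnMDl modn_small// eqxx.
by rewrite divnMDl// divn_small// addn0.
Qed.

Lemma sums_spread f l : sums_to f l -> sums_to (spread f) l.
Proof.
move=> fl e /fl[N hN]; exists (N * d)%N => n Nn.
rewrite spread_sum; apply: hN.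
by rewrite (leq_trans _ (leq_addr _ _))// leq_divRL.
Qed.

Lemma sqsum_spread f n : sqsum (spread f) n = sqsum f (c n).
Proof.
rewrite /sqsum -(spread_sum (fun k => nm (f k) ^+ 2)); apply: eq_bigr => k _.
by rewrite /spread; case: ifP => // _; rewrite nm0 expr0n.
Qed.

Lemma sqsum_unspread f n : sqsum (unspread f) n <= sqsum f (n * d).
Proof.
(* This turns the left side into a partial sum for [spread (unspread f)], which is f cut down to the
   residue class of i. *)
have -> : sqsum (unspread f) n = sqsum (unspread f) (c (n * d)).
  by rewrite /c mulnK// modnMl ltn0 addn0.
rewrite -sqsum_spread; apply: ler_sum => k _; rewrite /spread /unspread.
case: eqP => [<-|_]; first by rewrite -divn_eq.
by rewrite nm0 expr0n sqr_ge0.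
Qed.

Lemma spread_in (u : ell2 R) : spread u \in @sqsummable R.
Proof.
have [M uM] := ell2P u; apply/asboolP; exists M => n.
by rewrite sqsum_spread.
Qed.

Lemma unspread_in (u : ell2 R) : unspread u \in @sqsummable R.
Proof.
have [M uM] := ell2P u; apply/asboolP; exists M => n.
by rewrite (le_trans (sqsum_unspread _ _)).
Qed.

Definition shift (u : ell2 R) : ell2 R := Ell2 (spread_in u).
Definition unshift (u : ell2 R) : ell2 R := Ell2 (unspread_in u).

Lemma shift_bounded : bounded_op shift.
Proof.
apply/bounded_opP; split=> [a u w|].
  by apply/val_inj/funext => k; exact: (spread_lin a u w).
exists 1; split=> // u; rewrite mul1r; apply: ell2_norm_le => [|n].
  exact: ell2_norm_ge0.
by rewrite sqsum_spread sqsum_le_norm.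
Qed.

Lemma unshift_bounded : bounded_op unshift.
Proof.
apply/bounded_opP; split=> [a u w|]; first exact/val_inj/funext.
exists 1; split=> // u; rewrite mul1r; apply: ell2_norm_le => [|n].
  exact: ell2_norm_ge0.
by rewrite (le_trans (sqsum_unspread _ _))// sqsum_le_norm.
Qed.

Lemma shift_adjoint (u w : ell2 R) : inner (shift u) w = inner u (unshift w).
Proof.
apply: (sums_unique (ell2_innerP (shift u) w)).
have := sums_spread (ell2_innerP u (unshift w)).
congr sums_to; apply/funext => k; rewrite /spread /= /spread /unspread.
by case: eqP => [<-|_]; rewrite ?mul0r// -divn_eq.
Qed.

End Spread.

(** * Vector states and contractivity of representations *)

Section VectorStates.
Variables (R : realType) (H : hilbertType R[i]) (H_neq0 : exists x : H, x != 0).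

Lemma unit_vector : exists h : H, nm h = 1.
Proof.
case: H_neq0 => x x0.
have n0 : nm x != 0 by apply: contra_neq x0 => /nm0_eq0.
exists ((nm x)^-1%:C *: x); rewrite nmZ nmC ger0_norm ?invr_ge0 ?nm_ge0//.
by rewrite mulVf.
Qed.

Lemma vector_state (A : cstarAlgType R[i]) (f : A -> bop H_neq0) (h : H) :
  star_hom f -> nm h = 1 -> state (fun x => inner (f x h) h).
Proof.
move=> [lf f1 fM fS] h1; split.
- by move=> a x y; rewrite lf innerDl innerZl.
- by move=> x; rewrite fM fS bopME innerC -starE -innerC inner_nm ler0c sqr_ge0.
- by rewrite f1 inner_nm h1 expr1n.
Qed.

(** For a unit vector k, |f(x) k|^2 is the value at x^*x of the vector state of k, hence at most
    |x|^2. *)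
Lemma star_hom_contractive (A : cstarAlgType R[i]) (f : A -> bop H_neq0) x h :
  star_hom f -> nm (f x h) <= rnm x * nm h.
Proof.
move=> fh; have [h0|hn0] := eqVneq (nm h) 0.
  have -> : h = 0 by exact: nm0_eq0.
  have := linear_Z (bopP (f x)).1 0 0; rewrite !scale0r => ->.
  by rewrite nm0 mulr0.
have hp : 0 < nm h by rewrite lt_def hn0 nm_ge0.
have [k k1 ->] : exists2 k, nm k = 1 & h = (nm h)%:C *: k.
  exists ((nm h)^-1%:C *: h); last by rewrite scalerA -rmorphM divff// scale1r.
  by rewrite nmZ nmC ger0_norm ?invr_ge0 ?nm_ge0// mulVf.
rewrite (linear_Z (bopP (f x)).1) !nmZ k1 mulr1 mulrC ler_wpM2r ?nm_ge0//.
rewrite -ler_sqr ?nnegrE ?nm_ge0 ?rnm_ge0//.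
have := state_sqr_le (vector_state fh k1) x; have [_ _ fM fS] := fh.
by rewrite fM fS bopME innerC -starE -innerC inner_nm.
Qed.

End VectorStates.

Section StateExists.
Variables (R : realType) (d : nat) (d_gt0 : (0 < d)%N).

Lemma ell2_neq0 : exists u : ell2 R, u != 0.
Proof.
pose f : nat -> R[i] := fun k => (k == 0)%N%:R.
have f_in : f \in @sqsummable R.
  apply/asboolP; exists 1 => -[|n]; first by rewrite /sqsum big_ord0.
  rewrite /sqsum big_ord_recl big1 /= => [|k _]; last by rewrite nm0 expr0n.
  by rewrite addr0 (nmC 1) normr1 expr1n.
exists (Ell2 f_in); apply/eqP => /(congr1 (fun u : ell2 R => u 0%N)) /eqP.
by rewrite oner_eq0.
Qed.

Lemma bop_sumE (H : hilbertType R[i]) (H_neq0 : exists x : H, x != 0)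
    (I : Type) (r : seq I) (F : I -> bop H_neq0) x :
  (\sum_(i <- r) F i) x = \sum_(i <- r) F i x.
Proof. exact: (big_morph (fun T : bop H_neq0 => T x)). Qed.

Lemma ell2_sumE (I : Type) (r : seq I) (F : I -> ell2 R) k :
  (\sum_(i <- r) F i) k = \sum_(i <- r) F i k.
Proof. exact: (big_morph (fun u : ell2 R => u k)). Qed.

Lemma shift_cuntz :
  cuntz_isometries (fun i : 'I_d => bop_of ell2_neq0 (@shift_bounded R d i)).
Proof.
have starE i : star (bop_of ell2_neq0 (@shift_bounded R d i)) =
    bop_of ell2_neq0 (@unshift_bounded R d i).
  by apply: bop_star_unique => u w; exact: shift_adjoint.
split=> [i|].
  rewrite starE; apply: bop_ext => u; apply/val_inj.
  exact: (spreadK i u).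
apply: bop_ext => u; rewrite bop_sumE; under eq_bigr do rewrite bopME starE.
(* At coordinate k only the shift with index k mod d contributes. *)
apply/val_inj/funext => k /=; rewrite ell2_sumE (bigD1 (Ordinal (ltn_pmod k d_gt0)))//= big1 => [|i ik].
  by rewrite addr0 /= /spread /unspread /= eqxx -divn_eq.
by rewrite /= /spread; case: eqP => // e; case/eqP: ik; apply/val_inj.
Qed.

Lemma cuntz_state_exists (A : cstarAlgType R[i]) (v : 'I_d -> A) :
  cuntz_algebra v -> exists s : A -> R[i], state s.
Proof.
move=> [_ _ /(_ _ _ shift_cuntz)[f fh _]].
have [h h1] := unit_vector ell2_neq0.
by exists (fun x => inner (f x h) h); exact: vector_state.
Qed.

End StateExists.

(** * Embezzlement protocols *)

Section Embezzlement.
Variables (R : realType) (d : nat) (i0 : 'I_d) (alpha : 'I_d -> R).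
Hypothesis alphaP : schmidt_coefficients alpha.
Variables (H : hilbertType R[i]) (M : set (H -> H)) (T : 'I_d -> 'I_d -> H -> H).
Variable psi : H.
Hypothesis MvN : von_neumann_algebra M.
Hypothesis TE : exact_embezzlement i0 alpha M T psi.
Hypothesis psi_faithful : faithful_on M (vector_functional psi).

Let M_bounded X : M X -> bounded_op X.
Proof. by case: MvN => -[h _ _ _ _] _; exact: h. Qed.

Lemma embezzlement_nm_psi : nm psi = 1.
Proof. by case: TE => _ _ h _; apply: (@complexI R); rewrite -nmE h. Qed.

Lemma embezzlement_neq0 : exists x : H, x != 0.
Proof.
exists psi; apply/eqP => e; have := embezzlement_nm_psi.
by rewrite e nm0 => /eqP; rewrite eq_sym oner_eq0.
Qed.

Local Notation B := (bop embezzlement_neq0).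

Let col_bounded j : bounded_op (T j i0).
Proof. by case: TE => h _ _ _; exact/M_bounded/h. Qed.

Let X j : B := bop_of _ (col_bounded j).
Let inM (Y : B) := M (bop_val Y).
Let om (Y : B) : R[i] := inner (Y psi) psi.

Definition embezzlement_isometry j : B := star (X j).
Local Notation w := embezzlement_isometry.

Let om_state : state om.
Proof.
by apply: (@vector_state _ _ _ B idfun); [split|exact: embezzlement_nm_psi].
Qed.

Let inM1 : inM 1. Proof. by case: MvN => -[]. Qed.
Let inM_lin (a : R[i]) Y Z : inM Y -> inM Z -> inM (a *: Y + Z).
Proof. by case: MvN => -[_ _ h _ _] _; exact: h. Qed.
Let inMM Y Z : inM Y -> inM Z -> inM (Y * Z).
Proof. by case: MvN => -[_ _ _ h _] _; exact: h. Qed.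
Let inM_star Y : inM Y -> inM (star Y).
Proof. by case: MvN => -[_ _ _ _ h] _; exact: h. Qed.
Let inMB Y Z : inM Y -> inM Z -> inM (Y - Z).
Proof. by move=> hY hZ; rewrite addrC -scaleN1r; exact: inM_lin. Qed.
Let inM_sum (F : 'I_d -> B) : (forall i, inM (F i)) -> inM (\sum_i F i).
Proof.
move=> hF; elim/big_ind: _ => [|Y Z hY hZ|i _]; last exact: hF.
  by rewrite -(subrr 1); exact: inMB.
by rewrite -[Y]scale1r; exact: inM_lin.
Qed.
Let inMX j : inM (X j). Proof. by case: TE => h _ _ _; exact: h. Qed.
Let inMw j : inM (w j). Proof. exact/inM_star/inMX. Qed.

Let om_kms Y i j : inM Y ->
  om (w i * Y * star (w j)) = (i == j)%:R * (alpha i)%:C ^+ 2 * om Y.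
Proof.
move=> hY; case: TE => _ _ _ /(_ _ hY i j) <-.
by rewrite /w starK.
Qed.

(** Faithfulness is applied to 1 - Y, whose positivity is what the two conditions on the quadratic
    form express. *)
Let faithful_eq1 (Y : B) : inM Y -> (forall x, Re (inner (Y x) x) <= nm x ^+ 2) ->
  (forall x, Im (inner (Y x) x) = 0) -> om Y = 1 -> Y = 1.
Proof.
move=> hY Yle Yim Y1; apply/esym/subr0_eq; apply: val_inj.
apply: psi_faithful; first exact: (inMB inM1 hY).
- move=> x; rewrite -[(_ : H -> H) x]/(x - Y x) innerDl innerNl inner_nm lecE.
  by rewrite cImD cImN Yim cReD cReN /= !subr0 eqxx subr_ge0 Yle.
- by rewrite -[LHS]/(om (1 - Y)) (stateB om_state) (state1 om_state) Y1 subrr.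
Qed.

(** Contractivity tested on a vector of H^d supported in slot [i0], which sees only the column
    [i0]. *)
Let sum_le x : \sum_i nm (T i i0 x) ^+ 2 <= nm x ^+ 2.
Proof.
case: TE => _ hT _ _.
have := hT (fun j => if j == i0 then x else 0).
have bT i j : bounded_op (T i j) by case: TE => h _ _ _; exact/M_bounded/h.
have E i : \sum_j T i j (if j == i0 then x else 0) = T i i0 x.
  rewrite (bigD1 i0)//= eqxx big1 ?addr0// => j /negPf ->.
  by have := linear_Z (bT i j).1 0 0; rewrite !scale0r.
have E2 : \sum_j `|if j == i0 then x else 0| ^+ 2 = `|x| ^+ 2.
  by rewrite (bigD1 i0)//= eqxx big1 ?addr0// => j /negPf ->; rewrite normr0 expr0n.
rewrite E2; under eq_bigr do rewrite E nmE -rmorphXn.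
by rewrite nmE -rmorphXn -rmorph_sum lecR.
Qed.

Let star_w j : star (w j) = X j. Proof. exact: starK. Qed.

Let inner_ww j x : inner ((w j * star (w j)) x) x = (nm (T j i0 x) ^+ 2)%:C.
Proof. by rewrite star_w bopME innerC -starE -innerC inner_nm. Qed.

Lemma embezzlement_sum : \sum_j w j * star (w j) = 1.
Proof.
have E x : inner ((\sum_j w j * star (w j)) x) x = (\sum_j nm (T j i0 x) ^+ 2)%:C.
  rewrite bop_sumE rmorph_sum (big_morph (inner^~ x) (fun y z => innerDl y z x) (linear0l _ _)).
  by apply: eq_bigr => j _; exact: inner_ww.
apply: faithful_eq1 => [|x|x|].
- by apply: inM_sum => j; apply: inMM => //; exact: inM_star.
- by rewrite E; exact: sum_le.
- by rewrite E.
(* The protocol identity at X = 1 gives each term the value alpha_j^2. *)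
rewrite (state_sum om_state) -(alpha_sum alphaP); apply: eq_bigr => j _.
by have := om_kms j j inM1; rewrite mulr1 eqxx mul1r (state1 om_state) mulr1.
Qed.

(** With z = w_j x, |z|^2 = <T_(j,i0) z, x> <= |z| |x|, since each entry of the column is a
    contraction. *)
Let w_contractive j x : nm (w j x) <= nm x.
Proof.
set z := w j x; have [->|zn0] := eqVneq (nm z) 0; first exact: nm_ge0.
have zp : 0 < nm z by rewrite lt_def zn0 nm_ge0.
rewrite -(ler_pM2l zp) -expr2.
have -> : nm z ^+ 2 = Re (inner (T j i0 z) x).
  by rewrite -[T j i0 z]/(X j z) starE inner_nm.
rewrite (le_trans (CauchySchwarz_Re _ _))// ler_wpM2r ?nm_ge0//.
rewrite -ler_sqr ?nnegrE ?nm_ge0// (le_trans _ (sum_le z))//.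
by rewrite (bigD1 j)//= lerDl sumr_ge0// => k _; exact: sqr_ge0.
Qed.

Lemma embezzlement_isometric j : star (w j) * w j = 1.
Proof.
have E k x : inner ((star (w k) * w k) x) x = (nm (w k x) ^+ 2)%:C.
  by rewrite bopME star_w starE inner_nm.
have inMww k l : inM (star (w k) * w l) by apply: inMM => //; exact: inM_star.
(* All defects are nonnegative and they sum to 0; as alpha_k > 0, each [om (star (w k) * w k)] is
   1. *)
pose defect k := (alpha k)%:C ^+ 2 * (1 - om (star (w k) * w k)).
have defect_ge0 k : 0 <= defect k.
  rewrite mulr_ge0//; first by rewrite -rmorphXn ler0c sqr_ge0.
  rewrite /om E subr_ge0 lecR -(expr1n _ 2) -embezzlement_nm_psi.
  by rewrite ler_sqr ?nnegrE ?nm_ge0.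
have : \sum_k defect k == 0.
  rewrite /defect; under eq_bigr do rewrite mulrBr mulr1.
  rewrite sumrB (alpha_sum alphaP) subr_eq0 -(state1 om_state).
  rewrite -[1]mulr1 -embezzlement_sum mulr_suml (state_sum om_state).
  apply/eqP/eq_bigr => k _; rewrite mulr_sumr (state_sum om_state).
  rewrite (bigD1 k)//= big1 ?addr0 => [|l lk].
    rewrite -[w k * _ * _]mulrA [_ * (w k * _)]mulrA mulrA om_kms//.
    by rewrite eqxx mul1r.
  rewrite -[w k * _ * _]mulrA [_ * (w l * _)]mulrA mulrA om_kms//.
  by rewrite eq_sym (negPf lk) !mul0r.
rewrite psumr_eq0// => /allP/(_ j (mem_index_enum _)) /=.
rewrite mulf_eq0 => /orP[|/eqP/subr0_eq om1].
  rewrite -rmorphXn (inj_eq (@complexI R)) sqrf_eq0 gt_eqF//.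
  by case: alphaP => _ h _; exact: h.
apply: faithful_eq1 => // x; rewrite E//.
by rewrite /= ler_sqr ?nnegrE ?nm_ge0 ?w_contractive.
Qed.

Lemma embezzlement_cuntz : cuntz_isometries embezzlement_isometry.
Proof. by split; [exact: embezzlement_isometric|exact: embezzlement_sum]. Qed.

(** The universal property only lands in B(H). The elements sent into M form a star-subalgebra
    containing the generators, norm-closed because f is contractive and M is weakly closed. *)
Lemma embezzlement_hom (A : cstarAlgType R[i]) (v : 'I_d -> A) : cuntz_algebra v ->
  exists pi : A -> H -> H, star_hom_into M pi /\ (forall j, pi (v j) = adj (T j i0)).
Proof.
move=> [_ gen /(_ _ _ embezzlement_cuntz)[f fh fv]]; have [lf f1 fM fS] := fh.
exists (fun x => bop_val (f x)); split; last by move=> j; rewrite fv.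
split=> [a x y||x y|x|x]; rewrite ?lf ?f1 ?fM ?fS//.
pose S : set A := [set y | inM (f y)].
suff ST : S = setT by have : S x by rewrite ST.
apply: gen => [|y hy|i]; last by rewrite /S /= fv; exact: inMw.
  split=> [|a y z Sy Sz|y z Sy Sz|y Sy]; rewrite /S /=.
  - by rewrite f1; exact: inM1.
  - by rewrite lf; exact: inM_lin.
  - by rewrite fM; exact: inMM.
  - by rewrite fS; exact: inM_star.
case: MvN => _; apply; first exact: bopP.
move=> n h k e e0.
(* K dominates every |h l| |k l|, so one norm approximation serves all n matrix coefficients; the 1
   keeps K positive. *)
pose K := \sum_(l < n) nm (h l) * nm (k l) + 1.
have K0 : 0 < K by rewrite ltr_wpDl// sumr_ge0// => l _; rewrite mulr_ge0 ?nm_ge0.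
have [|z Sz yz] := hy (Re e / K)%:C; first by rewrite ltcR divr_gt0 ?gt0_Re.
exists (bop_val (f z)) => // l.
have -> : inner (f z (h l)) (k l) - inner (f y (h l)) (k l) =
    - inner (f (y - z) (h l)) (k l).
  have -> : f (y - z) = f y - f z.
    by rewrite addrC -scaleN1r lf scaleN1r addrC.
  by rewrite bopBE innerDl innerNl opprB.
rewrite normrN nmE (ge0_ReE (ltW e0)) ltcR.
move: yz; rewrite rnmE ltcR ltr_pdivlMr// => yz.
rewrite (le_lt_trans _ yz)// (le_trans (CauchySchwarz _ _))//.
apply: (@le_trans _ _ (rnm (y - z) * (nm (h l) * nm (k l)))).
  by rewrite mulrA ler_wpM2r ?nm_ge0// star_hom_contractive.
rewrite ler_wpM2l ?rnm_ge0// /K (bigD1 l)//= -addrA lerDl.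
by rewrite addr_ge0// sumr_ge0// => j _; rewrite mulr_ge0 ?nm_ge0.
Qed.

(** Stated for every homomorphism with the prescribed values on the generators, so that uniqueness
    of s identifies all of their marginals. *)
Lemma embezzlement_state (A : cstarAlgType R[i]) (v : 'I_d -> A) (pi : A -> H -> H) :
  star_hom_into M pi -> (forall j, pi (v j) = adj (T j i0)) ->
  state (fun x => vector_functional psi (pi x)) /\
  cuntz_kms alpha v (fun x => vector_functional psi (pi x)).
Proof.
move=> [lpi pi1 piM piS inMpi] piv; split; first split.
- by move=> a x y; rewrite lpi /vector_functional innerDl innerZl.
- move=> x; rewrite piM piS /vector_functional /= inner_adjl; last exact: M_bounded.
  by rewrite inner_nm ler0c sqr_ge0.
- by rewrite pi1 /vector_functional inner_nm embezzlement_nm_psi expr1n.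
move=> x i j; case: TE => _ _ _ /(_ _ (inMpi x) i j) <-.
by rewrite !piM piS !piv (adjK (col_bounded j)).
Qed.

End Embezzlement.

Theorem theorem3p2 (R : realType) (d : nat) (d_ge2 : (2 <= d)%N)
    (alpha : 'I_d -> R) (alphaP : schmidt_coefficients alpha)
    (O_d : cstarAlgType R[i]) (v : 'I_d -> O_d) (O_dP : cuntz_algebra v) :
  (exists! s : O_d -> R[i], state s /\ cuntz_kms alpha v s) /\
  (forall s : O_d -> R[i], state s -> cuntz_kms alpha v s ->
   forall (H : hilbertType R[i]) (M : set (H -> H))
     (T : 'I_d -> 'I_d -> H -> H) (psi : H),
   let i0 := Ordinal (ltnW d_ge2) in
   von_neumann_algebra M ->
   exact_embezzlement i0 alpha M T psi ->
   faithful_on M (vector_functional psi) ->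
   (exists pi : O_d -> H -> H,
      star_hom_into M pi /\ (forall j, pi (v j) = adj (T j i0))) /\
   (forall pi : O_d -> H -> H,
      star_hom_into M pi -> (forall j, pi (v j) = adj (T j i0)) ->
      forall x, s x = vector_functional psi (pi x))).
Proof.
have [vC gen _] := O_dP.
have unique := kms_unique d_ge2 alphaP vC.
split.
  have [s0 st0] := cuntz_state_exists (ltnW d_ge2) O_dP.
  have [s [st sK]] := kms_exists d_ge2 alphaP vC gen st0.
  by exists s; split=> // t [tt tK]; exact: unique.
move=> s st sK H M T psi i0 MvN TE psi_faithful; split.
  exact: (embezzlement_hom alphaP MvN TE psi_faithful O_dP).
move=> pi piH piv x; have [pst pK] := embezzlement_state MvN TE piH piv.
by rewrite (unique _ _ gen st sK pst pK).
Qed.
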